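(* Let $U\subset\mathbb C^2$ be the unit bidisk and $V=\{z\in U: z_1z_2=0\}$. There is no universal constant $C$, independent of the plurisubharmonic weight $\phi$ on $U$, such that the minimal extension $h$ satisfies $$\|h\|^2\le C\left(\int_V|f|^2e^{-\phi}\,d\lambda+\int_V|\partial^\phi f|^2e^{-\phi}\,d\lambda\right)$$ for all holomorphic functions $f$ on $V$ that vanish at the origin.
   Context: $A^2_\phi(U)$ is the space of holomorphic functions $h$ on $U$ with $\|h\|^2:=\int_U|h|^2e^{-\phi}d\lambda<\infty$, where $d\lambda$ is Lebesgue measure. A holomorphic function $f$ on $V$ is a pair $(f_1,f_2)$ where $f_1$ is holomorphic on $V_1=\{z_1=0\}$, $f_2$ is holomorphic on $V_2=\{z_2=0\}$, and $f_1(0)=f_2(0)$. An extension of $f$ is $h\in A^2_\phi(U)$ with $h=f_1$ on $V_1$ and $h=f_2$ on $V_2$; the minimal extension is the one of minimal norm. Integrals over $V$ are sums of the integrals over $V_1$ and $V_2$ with respect to Lebesgue measure on each disk. On each branch, $\partial^\phi f=e^{\phi}\partial(e^{-\phi}f)=\partial f-f\,\partial\phi$. *)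

(* Defs.v *)
(* MathComp-Analysis, over an arbitrary [R : realType]; the complex numbers are
   [R[i]], viewed as the normed module [R[i]^o] over themselves, so that
   [differentiable] and [derivable] mean complex differentiability. *)
From HB Require Import structures.
From mathcomp Require Import all_boot all_order all_algebra.
From mathcomp Require Import complex.
From mathcomp Require Import all_classical all_reals all_analysis.

Set Implicit Arguments.
Unset Strict Implicit.
Unset Printing Implicit Defensive.

Import Order.TTheory GRing.Theory Num.Theory.
Import numFieldNormedType.Exports.

Local Open Scope classical_set_scope.
Local Open Scope ring_scope.
Local Open Scope complex_scope.

Notation Cplx R := (R[i]^o)%type (only parsing).
Notation C2 R := ((R[i]^o * R[i]^o)%type) (only parsing).

(* The real-valued modulus (the library's [`|z|] lives in [R[i]]). *)
Definition modulus (R : realType) (z : Cplx R) : R := ComplexField.Normc.normc z.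

Definition unit_disk (R : realType) : set (Cplx R) := [set z | modulus z < 1].

Definition bidisk (R : realType) : set (C2 R) :=
  [set z | modulus z.1 < 1 /\ modulus z.2 < 1].

Definition holomorphic1 (R : realType) (D : set (Cplx R))
    (f : Cplx R -> Cplx R) : Prop :=
  forall z, D z -> derivable f z 1.

(* Differentiability at every point of the open set [D], the differential being
   linear over [R[i]]. *)
Definition holomorphic2 (R : realType) (D : set (C2 R))
    (h : C2 R -> Cplx R) : Prop :=
  forall z, D z -> differentiable h z.

Definition to_C (R : realType) (p : R * R) : Cplx R := p.1 +i* p.2.

Definition to_C2 (R : realType) (q : (R * R) * (R * R)) : C2 R :=
  (to_C q.1, to_C q.2).

Notation leb2 R :=
  ((@lebesgue_measure R) \x (@lebesgue_measure R))%E (only parsing).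

Definition integral_C (R : realType) (D : set (Cplx R))
    (F : Cplx R -> \bar R) : \bar R :=
  (\int[(leb2 R)]_(p in [set p | D (to_C p)]) F (to_C p))%E.

Definition integral_C2 (R : realType) (D : set (C2 R))
    (F : C2 R -> \bar R) : \bar R :=
  (\int[(leb2 R \x leb2 R)%E]_(q in [set q | D (to_C2 q)]) F (to_C2 q))%E.

Definition on_line (R : realType) (a b : C2 R) (zeta : Cplx R) : C2 R :=
  (a.1 + zeta * b.1, a.2 + zeta * b.2).

(* Plurisubharmonic functions with values in [-oo, +oo[, not identically -oo:
   upper semicontinuity, and the sub-mean value inequality on the circle
   [a + e^{it} b] whenever the closed disk [a + zeta b], [|zeta| <= 1],
   is contained in [D]. *)
Definition psh (R : realType) (D : set (C2 R)) (phi : C2 R -> \bar R) : Prop :=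
  [/\ forall z, D z -> (phi z < +oo)%E,
      exists2 z, D z & (-oo < phi z)%E,
      forall z, D z -> forall c : R, (phi z < c%:E)%E ->
        \forall w \near z, D w -> (phi w < c%:E)%E &
      forall a b : C2 R,
        (forall zeta : Cplx R, modulus zeta <= 1 ->
           D (on_line a b zeta)) ->
        ((2 * pi)%:E * phi a <=
           \int[@lebesgue_measure R]_(t in `[0%R, (2 * pi)%R])
             phi (on_line a b (cos t +i* sin t)))%E].

(* [|w|^2 e^{-t}], in [0, +oo], with the convention 0 * (+oo) = 0 when
   [t = -oo]. *)
Definition wsq (R : realType) (w : Cplx R) (t : \bar R) : \bar R :=
  ((modulus w ^+ 2)%:E * expeR (- t))%E.

Definition sqnorm (R : realType) (phi : C2 R -> \bar R) (h : C2 R -> Cplx R) :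
    \bar R :=
  integral_C2 (@bidisk R) (fun z => wsq (h z) (phi z)).

Definition bergman (R : realType) (phi : C2 R -> \bar R)
    (h : C2 R -> Cplx R) : Prop :=
  holomorphic2 (@bidisk R) h /\ (sqnorm phi h < +oo)%E.

(* The branch V_1 = {z_1 = 0} is parametrized by [w |-> (0, w)] and
   V_2 = {z_2 = 0} by [w |-> (w, 0)]. *)
Definition on_V1 (R : realType) (T : Type) (g : C2 R -> T) (w : Cplx R) : T :=
  g (0, w).

Definition on_V2 (R : realType) (T : Type) (g : C2 R -> T) (w : Cplx R) : T :=
  g (w, 0).

Definition holomorphic_on_V (R : realType) (f1 f2 : Cplx R -> Cplx R) : Prop :=
  [/\ holomorphic1 (@unit_disk R) f1,
      holomorphic1 (@unit_disk R) f2 & f1 0 = f2 0].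

Definition extension (R : realType) (phi : C2 R -> \bar R)
    (f1 f2 : Cplx R -> Cplx R) (h : C2 R -> Cplx R) : Prop :=
  [/\ bergman phi h,
      forall w, unit_disk w -> on_V1 h w = f1 w &
      forall w, unit_disk w -> on_V2 h w = f2 w].

Definition minimal_extension (R : realType) (phi : C2 R -> \bar R)
    (f1 f2 : Cplx R -> Cplx R) (h : C2 R -> Cplx R) : Prop :=
  extension phi f1 f2 h /\
  forall g, extension phi f1 f2 g -> (sqnorm phi h <= sqnorm phi g)%E.

(* The Wirtinger derivative (d/dx - i d/dy)/2 of a real function.  A subharmonic
   function that is not identically -oo is absolutely continuous on almost every
   line, so its pointwise partial derivatives exist almost everywhere and
   represent its distributional derivatives. *)
Definition wirtinger (R : realType) (psi : Cplx R -> \bar R) (z : Cplx R) :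
    Cplx R :=
  (derive1 (fun x : R => fine (psi (x +i* complex.Im z))) (complex.Re z) / 2)
  +i* (- (derive1 (fun y : R => fine (psi (complex.Re z +i* y)))
            (complex.Im z)) / 2).

(* For holomorphic [f], the derivative [df/dz] is the complex derivative. *)
Definition twisted_d (R : realType) (psi : Cplx R -> \bar R)
    (f : Cplx R -> Cplx R) (z : Cplx R) : Cplx R :=
  'D_1 f z - f z * wirtinger psi z.

Definition sqnorm_V (R : realType) (phi : C2 R -> \bar R)
    (f1 f2 : Cplx R -> Cplx R) : \bar R :=
  (integral_C (@unit_disk R) (fun w => wsq (f1 w) (on_V1 phi w)) +
   integral_C (@unit_disk R) (fun w => wsq (f2 w) (on_V2 phi w)))%E.

(* Main.v *)
(* The counterexample is phi = ln (|z1 + z2|^2 + eps^2) with f = -w on V1 and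
   f = w on V2, as eps tends to 0.  The weight is invariant under the rotations
   z |-> e^{it} z, and every extension of f has the linear part h = z1 - z2, so
   that averaging e^{-it} g(e^{it} z) over t recovers h from any extension g;
   since this averaging does not increase the norm, h is the minimal extension.
   On the branches |f|^2 e^{-phi} <= 1 and |d^phi f|^2 e^{-phi} equals
   eps^4 / (|w|^2 + eps^2)^3 <= eps / (x^2 + eps^2) * eps / (y^2 + eps^2),
   so the right-hand side stays bounded, whereas |h|^2 e^{-phi} is of the order
   of 1 / (|z1 + z2|^2 + eps^2) near the line z1 + z2 = 0, and its integral
   grows like ln (1 / eps).
   Differentiability is only assumed pointwise, so the mean value property of g
   goes through Goursat's bisection argument. *)
Require Import Defs.
From HB Require Import structures.
From mathcomp Require Import all_boot all_order all_algebra.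
From mathcomp Require Import complex.
From mathcomp Require Import all_classical all_reals all_analysis.
From mathcomp Require Import measurable_realfun.
From mathcomp Require Import ring lra.

Set Implicit Arguments.
Unset Strict Implicit.
Unset Printing Implicit Defensive.

Import Order.TTheory GRing.Theory Num.Theory.
Import numFieldNormedType.Exports.

Local Open Scope classical_set_scope.
Local Open Scope ring_scope.

(** The line [z1 + z2 = 0], along which [e^{-phi}] concentrates, meets V only at the origin, where f
    vanishes; off the origin the linear function [z1 - z2] has no zero on that line. This is why the
    branches do not see the concentration and the extension does. No averaged function is ever
    formed. For a fixed [z] the mean value property gives an inequality between [|z1 - z2|^2] and
    the mean of [|g|^2] over the circle [e^{it} z]; Tonelli and the rotation invariance of Lebesgue
    measure turn it into an inequality of norms. With only pointwise derivatives the mean value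
    property cannot start from a continuous derivative. In the coordinate [w] with [t = e^w] the
    punctured disk becomes a half plane and each circle a vertical segment, so Goursat's theorem for
    rectangles suffices: periodicity cancels the horizontal sides. Plurisubharmonicity of the weight
    needs one half of Jensen's formula, the nonnegativity of the mean of [ln |1 + c e^{it}|^2] for
    [|c| < 1]. It is obtained by doubling the angle, with no theory of harmonic functions. *)

(** * Goursat's theorem on rectangles and the mean value property *)

(** If [F] were nonzero, one quarter of the rectangle would carry at least a quarter of its absolute
    value. Iterating gives nested rectangles with sides scaled by [2^-n] and [|F|] at least [4^-n]
    times the original value, which contradicts smallness at their common point. *)
Lemma rectangle_bisection (R : realType) (F : R -> R -> R -> R -> R)
    (x0 x1 y0 y1 : R) :
  x0 <= x1 -> y0 <= y1 ->
  (forall a b c y y', x0 <= a -> a <= b -> b <= c -> c <= x1 ->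
     y0 <= y -> y <= y' -> y' <= y1 ->
     F a c y y' = F a b y y' + F b c y y') ->
  (forall x x' a b c, x0 <= x -> x <= x' -> x' <= x1 ->
     y0 <= a -> a <= b -> b <= c -> c <= y1 ->
     F x x' a c = F x x' a b + F x x' b c) ->
  (forall x y, x0 <= x <= x1 -> y0 <= y <= y1 -> forall e : R, 0 < e ->
     exists2 d : R, 0 < d & forall a b a' b',
       x0 <= a -> a <= x -> x <= b -> b <= x1 ->
       y0 <= a' -> a' <= y -> y <= b' -> b' <= y1 ->
       b - a < d -> b' - a' < d ->
       `|F a b a' b'| <= e * ((b - a) + (b' - a')) ^+ 2) ->
  F x0 x1 y0 y1 = 0.
Proof.
move=> x01 y01 addx addy small; apply/eqP/negPn/negP => F0.
pose good (q : R * R * (R * R)) := [/\ x0 <= q.1.1, q.1.1 <= q.1.2,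
  q.1.2 <= x1, y0 <= q.2.1 & q.2.1 <= q.2.2 /\ q.2.2 <= y1].
pose Fq (q : R * R * (R * R)) := `|F q.1.1 q.1.2 q.2.1 q.2.2|.
pose half (q q' : R * R * (R * R)) := [/\ good q',
  q.1.1 <= q'.1.1 /\ q'.1.2 <= q.1.2, q.2.1 <= q'.2.1 /\ q'.2.2 <= q.2.2,
  q'.1.2 - q'.1.1 = (q.1.2 - q.1.1) / 2 /\ q'.2.2 - q'.2.1 = (q.2.2 - q.2.1) / 2
  & Fq q <= 4 * Fq q'].
(* The condition [good q] sits inside the existential so that [choice] yields a total map, which can
   be iterated. *)
have halfP q : exists q', good q -> half q q'.
  have [gq|ngq] := pselect (good q); last by exists q => /ngq.
  case: q gq => -[a c] [a' c'] [/= h1 h2 h3 h4 [h5 h6]].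
  pose b := (a + c) / 2; pose b' := (a' + c') / 2.
  have ab : a <= b by rewrite /b; lra.
  have bc : b <= c by rewrite /b; lra.
  have ab' : a' <= b' by rewrite /b'; lra.
  have bc' : b' <= c' by rewrite /b'; lra.
  have E : F a c a' c' = (F a b a' b' + F a b b' c') + (F b c a' b' + F b c b' c').
    rewrite (addx a b c)//.
    by congr (_ + _); apply: addy; rewrite // ?(le_trans h1) // (le_trans bc).
  have T : `|F a c a' c'| <=
    (`|F a b a' b'| + `|F a b b' c'|) + (`|F b c a' b'| + `|F b c b' c'|).
    by rewrite E (le_trans (ler_normD _ _))// lerD// ler_normD.
  have hb1 : b - a = (c - a) / 2 by rewrite /b; lra.
  have hb2 : c - b = (c - a) / 2 by rewrite /b; lra.
  have hb1' : b' - a' = (c' - a') / 2 by rewrite /b'; lra.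
  have hb2' : c' - b' = (c' - a') / 2 by rewrite /b'; lra.
  have xb := le_trans h1 ab; have bx := le_trans bc h3.
  have yb := le_trans h4 ab'; have yx := le_trans bc' h6.
  have mk u v u' v' : (u = a /\ v = b) \/ (u = b /\ v = c) ->
      (u' = a' /\ v' = b') \/ (u' = b' /\ v' = c') ->
      `|F a c a' c'| <= 4 * `|F u v u' v'| ->
      exists q', good (a, c, (a', c')) -> half (a, c, (a', c')) q'.
    by move=> [[-> ->]|[-> ->]] [[-> ->]|[-> ->]] l;
      eexists (_, _, (_, _)) => _; split; rewrite /good /Fq /=; try exact: l.
  have [t1|t1] := leP `|F a c a' c'| (4 * `|F a b a' b'|).
    by apply: (mk _ _ _ _ _ _ t1); [left|left].
  have [t2|t2] := leP `|F a c a' c'| (4 * `|F a b b' c'|).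
    by apply: (mk _ _ _ _ _ _ t2); [left|right].
  have [t3|t3] := leP `|F a c a' c'| (4 * `|F b c a' b'|).
    by apply: (mk _ _ _ _ _ _ t3); [right|left].
  apply: (mk b c b' c'); [by right|by right|].
  by move: T t1 t2 t3; clear; lra.
have [f fP] := choice halfP.
pose q n := iter n f ((x0, x1), (y0, y1)).
have gq n : good (q n).
  by elim: n => [|n /fP[]//]; split.
have hq n : half (q n) (q n.+1) by exact: fP.
have mono n m : (n <= m)%N -> [/\ (q n).1.1 <= (q m).1.1, (q m).1.2 <= (q n).1.2,
   (q n).2.1 <= (q m).2.1 & (q m).2.2 <= (q n).2.2].
  move=> /subnK <-; elim: (m - n)%N => [|k [i1 i2 i3 i4]]; first by rewrite add0n.
  have [_ [j1 j2] [j3 j4] _ _] := hq (k + n)%N.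
  by rewrite addSn; split; [exact: le_trans j1|exact: le_trans i2|exact: le_trans
      j3|exact: le_trans i4].
have size n : (q n).1.2 - (q n).1.1 = (x1 - x0) / 2 ^+ n /\
   (q n).2.2 - (q n).2.1 = (y1 - y0) / 2 ^+ n /\ `|F x0 x1 y0 y1| <= 4 ^+ n * Fq (q n).
  elim: n => [|n [IH1 [IH2 IH3]]].
    by rewrite !expr0 !divr1 mul1r /Fq /=; split => //; split.
  have [_ _ _ [e1 e2] e3] := hq n.
  rewrite e1 e2 IH1 IH2 exprSr invfM !mulrA; split => //; split => //.
  apply: (le_trans IH3); rewrite exprSr -mulrA ler_wpM2l//.
(* The point common to all nested rectangles. *)
pose X := sup (range (fun n => (q n).1.1)); pose Y := sup (range (fun n => (q n).2.1)).
have crossx n m : (q n).1.1 <= (q m).1.2.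
  have [l1 _ _ _] := mono _ _ (leq_maxl n m); have [_ l2 _ _] := mono _ _ (leq_maxr n m).
  have [_ l3 _ _ _] := gq (maxn n m).
  exact: le_trans l1 (le_trans l3 l2).
have crossy n m : (q n).2.1 <= (q m).2.2.
  have [_ _ l1 _] := mono _ _ (leq_maxl n m); have [_ _ _ l2] := mono _ _ (leq_maxr n m).
  have [_ _ _ _ [l3 _]] := gq (maxn n m).
  exact: le_trans l1 (le_trans l3 l2).
have Xl n : (q n).1.1 <= X.
  apply: ub_le_sup; last by exists n.
  by exists (q 0%N).1.2 => _ [m _ <-].
have Xr n : X <= (q n).1.2.
  by apply: ge_sup; [exists (q 0%N).1.1, 0%N|move=> _ [m _ <-]].
have Yl n : (q n).2.1 <= Y.
  apply: ub_le_sup; last by exists n.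
  by exists (q 0%N).2.2 => _ [m _ <-].
have Yr n : Y <= (q n).2.2.
  by apply: ge_sup; [exists (q 0%N).2.1, 0%N|move=> _ [m _ <-]].
(* The [+ 1] keeps the denominator positive even when the rectangle is a single point. *)
pose e := `|F x0 x1 y0 y1| / (2 * ((x1 - x0 + (y1 - y0)) ^+ 2 + 1)).
have wh : 0 <= (x1 - x0 + (y1 - y0)) ^+ 2 by exact: sqr_ge0.
have Fgt : 0 < `|F x0 x1 y0 y1| by rewrite normr_gt0.
have e0 : 0 < e by rewrite /e divr_gt0//; lra.
have [||d d0 dP] := small X Y _ _ e e0.
- by rewrite (Xl 0%N) (Xr 0%N).
- by rewrite (Yl 0%N) (Yr 0%N).
have [n nd] : exists n : nat, ((x1 - x0) + (y1 - y0)) / 2 ^+ n < d.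
  have /cvgr0Pnorm_lt/(_ _ d0) [N _ /(_ N (leqnn N))] :
      (fun n => ((x1 - x0) + (y1 - y0)) / 2 ^+ n) @ \oo --> (0 : R).
    rewrite -(mulr0 ((x1 - x0) + (y1 - y0))); apply: cvgMr.
    under eq_fun do rewrite -exprVn.
    by apply: cvg_expr; rewrite ger0_norm ?invr_ge0// invf_lt1 ?ltr1n.
  by move=> H; exists N; apply: le_lt_trans H; exact: ler_norm.
have [g1 g2 g3 g4 [g5 g6]] := gq n; have [s1 [s2 s3]] := size n.
have p2 : 0 < (2 : R) ^+ n by exact: exprn_gt0.
have pw : 0 <= (x1 - x0) / 2 ^+ n by rewrite divr_ge0 ?subr_ge0// ltW.
have ph : 0 <= (y1 - y0) / 2 ^+ n by rewrite divr_ge0 ?subr_ge0// ltW.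
have := dP _ _ _ _ g1 (Xl n) (Xr n) g3 g4 (Yl n) (Yr n) g6.
rewrite s1 s2 => /(_ _ _)/wrap [||].
- by move: nd; rewrite mulrDl; lra.
- by move: nd; rewrite mulrDl; lra.
rewrite -mulrDl exprMn exprVn => K.
have : `|F x0 x1 y0 y1| <= e * (x1 - x0 + (y1 - y0)) ^+ 2.
  apply: (le_trans s3); apply: (le_trans (ler_wpM2l _ K)).
    by rewrite exprn_ge0.
  rewrite (_ : 4 = 2 * 2) ?exprMn; last by lra.
  rewrite [leLHS](_ : _ = e * (x1 - x0 + (y1 - y0)) ^+ 2)//.
  by field; rewrite lt0r_neq0.
rewrite leNgt => /negP; apply.
rewrite /e mulrAC ltr_pdivrMr; last by lra.
by rewrite ltr_pM2l//; lra.
Qed.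

Lemma integrable_continuous_itv (R : realType) (f : R -> R) (a b : R) :
  (forall x, a <= x <= b -> {for x, continuous f}) ->
  (@lebesgue_measure R).-integrable `[a, b] (EFin \o f).
Proof.
move=> cf; apply: continuous_compact_integrable; first exact: segment_compact.
by apply: continuous_in_subspaceT => x /set_mem /=; rewrite in_itv => /cf.
Qed.

Lemma Rintegral_itv_cat (R : realType) (f : R -> R) (a b c : R) :
  a <= b -> b <= c ->
  (@lebesgue_measure R).-integrable `[a, c] (EFin \o f) ->
  \int[@lebesgue_measure R]_(x in `[a, c]) f x =
  \int[@lebesgue_measure R]_(x in `[a, b]) f x +
  \int[@lebesgue_measure R]_(x in `[b, c]) f x.
Proof.
move=> ab bc intf; have := @Rintegral_itvB R f (BLeft a) (BRight c) b intf.
rewrite !bnd_simp => /(_ ab bc) /eqP; rewrite subr_eq => /eqP ->.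
rewrite addrC; congr (_ + _); apply: Rintegral_itv_obnd_cbnd.
by apply: integrableS intf => //; apply: subset_itvr; rewrite bnd_simp.
Qed.

Lemma Rintegral_itv_cst (R : realType) (a b k : R) : a <= b ->
  \int[@lebesgue_measure R]_(x in `[a, b]) k = k * (b - a).
Proof.
move=> ab; rewrite Rintegral_cst//= lebesgue_measure_itv/= lte_fin.
by case: ltgtP ab => [//|//|->] _; rewrite subrr.
Qed.

Lemma Rintegral_dist_cst (R : realType) (f : R -> R) (a b k m : R) : a <= b ->
  (@lebesgue_measure R).-integrable `[a, b] (EFin \o f) ->
  (forall x, a <= x <= b -> `|f x - k| <= m) ->
  `|\int[@lebesgue_measure R]_(x in `[a, b]) f x - k * (b - a)| <= m * (b - a).
Proof.
move=> ab intf fk.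
have intc (k' : R) : (@lebesgue_measure R).-integrable `[a, b] (EFin \o (fun=> k')).
  by apply: integrable_continuous_itv => x _; exact: cvg_cst.
rewrite -!Rintegral_itv_cst// -RintegralB//.
have intB : (@lebesgue_measure R).-integrable `[a, b] (EFin \o (fun x => f x - k)).
  by apply: (integrableB _ intf (intc k)).
apply: (le_trans (le_normr_Rintegral _ intB)) => //.
by apply: le_Rintegral => //; exact: integrable_norm.
Qed.

(* [P dx + Q dy] is differentiable at [(x, y)], with [dP/dy = dQ/dx]. *)
Definition closed_at (R : realType) (P Q : R -> R -> R) (x y : R) :=
  exists a b c : R, forall e : R, 0 < e -> exists2 d : R, 0 < d & forall x' y',
    `|x' - x| < d -> `|y' - y| < d ->
    `|P x' y' - (P x y + a * (x' - x) + b * (y' - y))|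
      <= e * (`|x' - x| + `|y' - y|) /\
    `|Q x' y' - (Q x y + b * (x' - x) + c * (y' - y))|
      <= e * (`|x' - x| + `|y' - y|).

(** Gives the integrability of [P] along horizontal sides and of [Q] along vertical ones. *)
Lemma closed_at_continuous (R : realType) (P Q : R -> R -> R) (x y : R) :
  closed_at P Q x y ->
  {for x, continuous (P ^~ y)} /\ {for y, continuous (Q x)}.
Proof.
move=> [a [b [c H]]]; split.
- apply/cvgrPdist_lt => e e0; have [d d0 dP] := H 1 ltr01.
  have K : 0 < 2 + `|a| by rewrite ltr_wpDr.
  apply/nbhs_ballP; exists (Num.min d (e / (2 + `|a|))).
    by rewrite /= lt_min d0 divr_gt0.
  move=> t; rewrite /ball /= lt_min distrC => /andP[td te].
  have [] := dP t y td; first by rewrite subrr normr0.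
  rewrite subrr normr0 mulr0 !addr0 mul1r => h _.
  rewrite distrC; apply: le_lt_trans (_ : (1 + `|a|) * `|t - x| < _).
    rewrite mulrDl mul1r -normrM.
    by rewrite (le_trans _ (lerD h (lexx _)))// (le_trans _ (ler_normD _ _))// opprD
        !addrA subrK.
  move: te; rewrite ltr_pdivlMr// mulrC; apply: le_lt_trans.
  by rewrite ler_wpM2r// lerD2r ler1n.
- apply/cvgrPdist_lt => e e0; have [d d0 dP] := H 1 ltr01.
  have K : 0 < 2 + `|c| by rewrite ltr_wpDr.
  apply/nbhs_ballP; exists (Num.min d (e / (2 + `|c|))).
    by rewrite /= lt_min d0 divr_gt0.
  move=> t; rewrite /ball /= lt_min distrC => /andP[td te].
  have [|_] := dP x t _ td; first by rewrite subrr normr0.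
  rewrite subrr normr0 mulr0 addr0 add0r mul1r => h.
  rewrite distrC; apply: le_lt_trans (_ : (1 + `|c|) * `|t - y| < _).
    rewrite mulrDl mul1r -normrM.
    by rewrite (le_trans _ (lerD h (lexx _)))// (le_trans _ (ler_normD _ _))// opprD
        !addrA subrK.
  move: te; rewrite ltr_pdivlMr// mulrC; apply: le_lt_trans.
  by rewrite ler_wpM2r// lerD2r ler1n.
Qed.

(** The boundary integral is additive under both kinds of cuts, since the inner sides cancel. It is
    small on small rectangles because the linear part of a form with [dP/dy = dQ/dx] integrates to
    zero. *)
Lemma goursat_rectangle (R : realType) (P Q : R -> R -> R) (x0 x1 y0 y1 : R) :
  x0 <= x1 -> y0 <= y1 ->
  (forall x y, x0 <= x <= x1 -> y0 <= y <= y1 -> closed_at P Q x y) ->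
  \int[@lebesgue_measure R]_(x in `[x0, x1]) (P x y0 - P x y1) +
  \int[@lebesgue_measure R]_(y in `[y0, y1]) (Q x1 y - Q x0 y) = 0.
Proof.
move=> x01 y01 H; pose mu := @lebesgue_measure R.
have iP y a b : y0 <= y <= y1 -> x0 <= a -> b <= x1 ->
    mu.-integrable `[a, b] (EFin \o P ^~ y).
  move=> yin a0 b1; apply: integrable_continuous_itv => x /andP[ax xb].
  by have [] := closed_at_continuous (H x y _ yin);
    first rewrite (le_trans a0 ax) (le_trans xb).
have iQ x a b : x0 <= x <= x1 -> y0 <= a -> b <= y1 ->
    mu.-integrable `[a, b] (EFin \o Q x).
  move=> xin a0 b1; apply: integrable_continuous_itv => y /andP[ay yb].
  by have [] := closed_at_continuous (H x y xin _);
    first rewrite (le_trans a0 ay) (le_trans yb).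
have iP2 y y' a b : y0 <= y <= y1 -> y0 <= y' <= y1 -> x0 <= a -> b <= x1 ->
    mu.-integrable `[a, b] (EFin \o (fun x => P x y - P x y')).
  by move=> h1 h2 h3 h4; apply: (integrableB _ (iP _ _ _ h1 h3 h4) (iP _ _ _ h2 h3 h4)).
have iQ2 x x' a b : x0 <= x <= x1 -> x0 <= x' <= x1 -> y0 <= a -> b <= y1 ->
    mu.-integrable `[a, b] (EFin \o (fun y => Q x y - Q x' y)).
  by move=> h1 h2 h3 h4; apply: (integrableB _ (iQ _ _ _ h1 h3 h4) (iQ _ _ _ h2 h3 h4)).
apply: (@rectangle_bisection _ (fun a b c d =>
    \int[mu]_(x in `[a, b]) (P x c - P x d) +
    \int[mu]_(y in `[c, d]) (Q b y - Q a y)) x0 x1 y0 y1) => //.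
- move=> a b c y y' xa ab bc cx yy0 yy' yy1.
  have yin : y0 <= y <= y1 by rewrite yy0 (le_trans yy').
  have y'in : y0 <= y' <= y1 by rewrite yy1 (le_trans yy0).
  rewrite (Rintegral_itv_cat ab bc) ?iP2//.
  have bin : x0 <= b <= x1 by rewrite (le_trans xa)//= (le_trans bc).
  have ain : x0 <= a <= x1 by rewrite xa (le_trans ab)// (le_trans bc).
  have cin : x0 <= c <= x1 by rewrite cx (le_trans xa)// (le_trans ab).
  rewrite addrACA -RintegralD//; [|exact: iQ2|exact: iQ2].
  by congr (_ + _); apply: eq_Rintegral => t _; rewrite [RHS]addrC addrA subrK.
- move=> x x' a b c xx0 xx' xx1 ya ab bc cy.
  have bin : y0 <= b <= y1 by rewrite (le_trans ya)//= (le_trans bc).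
  have ain : y0 <= a <= y1 by rewrite ya (le_trans ab)// (le_trans bc).
  have cin : y0 <= c <= y1 by rewrite cy (le_trans ya)// (le_trans ab).
  have xin : x0 <= x <= x1 by rewrite xx0 (le_trans xx').
  have x'in : x0 <= x' <= x1 by rewrite xx1 (le_trans xx0).
  rewrite (Rintegral_itv_cat ab bc) ?iQ2// addrACA -RintegralD//; [|exact: iP2|exact:
      iP2].
  by congr (_ + _); apply: eq_Rintegral => t _; rewrite [RHS]addrA subrK.
- move=> x y xin yin e e0; have [p [b [q cl]]] := H x y xin yin.
  (* Each integrand below is a difference of two values, and each value contributes an error with
     factor [e / 2]. *)
  have e2 : 0 < e / 2 by lra.
  have [d d0 dP] := cl _ e2; exists d => // l r l' r' xl lx xr rx yl ly yr ry rl rl'.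
  pose w := r - l; pose h := r' - l'.
  have nx t : l <= t <= r -> `|t - x| < d /\ `|t - x| <= w.
    by move=> /andP[lt tr]; rewrite ltr_norml ler_norml /w; split; lra.
  have ny t : l' <= t <= r' -> `|t - y| < d /\ `|t - y| <= h.
    by move=> /andP[lt tr]; rewrite ltr_norml ler_norml /h; split; lra.
  have [|nl nl2] := nx l; first by rewrite lexx/= (le_trans lx).
  have [|nr nr2] := nx r; first by rewrite lexx andbT (le_trans lx).
  have [|nl' nl2'] := ny l'; first by rewrite lexx/= (le_trans ly).
  have [|nr' nr2'] := ny r'; first by rewrite lexx andbT (le_trans ly).
  have lr : l <= r by exact: le_trans lx xr.
  have lr' : l' <= r' by exact: le_trans ly yr.
  have l'in : y0 <= l' <= y1 by rewrite yl (le_trans ly)//; case/andP: yin.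
  have r'in : y0 <= r' <= y1 by rewrite ry (le_trans _ yr)//; case/andP: yin.
  have lin : x0 <= l <= x1 by rewrite xl (le_trans lx)//; case/andP: xin.
  have rin : x0 <= r <= x1 by rewrite rx (le_trans _ xr)//; case/andP: xin.
  (* To first order [P t l' - P t r'] is [- b h] and [Q r t - Q l t] is [b w]. Integrated over sides
     of length [w] and [h] these cancel, and the errors [e (w + h) w] and [e (w + h) h] add up to
     [e (w + h)^2]. *)
  have K1 := @Rintegral_dist_cst _ (fun t => P t l' - P t r') l r (- b * h)
    (e * (w + h)) lr (iP2 _ _ _ _ l'in r'in xl rx).
  have K2 := @Rintegral_dist_cst _ (fun t => Q r t - Q l t) l' r' (b * w)
    (e * (w + h)) lr' (iQ2 _ _ _ _ rin lin yl ry).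
  have {}K1 : `|\int[mu]_(t in `[l, r]) (P t l' - P t r') - - b * h * w| <=
      e * (w + h) * w.
    apply: K1 => t /nx[t1 t2].
    have [j1 _] := dP t l' t1 nl'; have [j2 _] := dP t r' t1 nr'.
    have m1 : e / 2 * (`|t - x| + `|l' - y|) <= e / 2 * (w + h).
      by apply: (ler_wpM2l (ltW e2)); exact: lerD.
    have m2 : e / 2 * (`|t - x| + `|r' - y|) <= e / 2 * (w + h).
      by apply: (ler_wpM2l (ltW e2)); exact: lerD.
    rewrite (_ : P t l' - P t r' - - b * h =
      (P t l' - (P x y + p * (t - x) + b * (l' - y))) -
      (P t r' - (P x y + p * (t - x) + b * (r' - y)))); last by rewrite /h; ring.
    rewrite (le_trans (ler_normB _ _))// (le_trans (lerD (le_trans j1 m1) (le_trans j2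
        m2)))//.
    by rewrite -mulrDl -splitr.
  have {}K2 : `|\int[mu]_(t in `[l', r']) (Q r t - Q l t) - b * w * h| <=
      e * (w + h) * h.
    apply: K2 => t /ny[t1 t2].
    have [_ j1] := dP r t nr t1; have [_ j2] := dP l t nl t1.
    have m1 : e / 2 * (`|r - x| + `|t - y|) <= e / 2 * (w + h).
      by apply: (ler_wpM2l (ltW e2)); exact: lerD.
    have m2 : e / 2 * (`|l - x| + `|t - y|) <= e / 2 * (w + h).
      by apply: (ler_wpM2l (ltW e2)); exact: lerD.
    rewrite (_ : Q r t - Q l t - b * w =
      (Q r t - (Q x y + b * (r - x) + q * (t - y))) -
      (Q l t - (Q x y + b * (l - x) + q * (t - y)))); last by rewrite /w; ring.
    rewrite (le_trans (ler_normB _ _))// (le_trans (lerD (le_trans j1 m1) (le_trans j2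
        m2)))//.
    by rewrite -mulrDl -splitr.
  rewrite -/w -/h; set I1 := Rintegral _ _ _ in K1 *; set I2 := Rintegral _ _ _ in K2 *.
  rewrite (_ : I1 + I2 = (I1 - - b * h * w) + (I2 - b * w * h)); last by ring.
  rewrite (le_trans (ler_normD _ _))// (le_trans (lerD K1 K2))//.
  by rewrite -mulrDr expr2 mulrA.
Qed.

(* With [x + i y] a logarithmic polar coordinate, [{x} * [0, 2 pi]] is a circle,
   which shrinks to the centre as [x] tends to [-oo]. *)
Lemma mean_value_circle (R : realType) (P Q : R -> R -> R) (x1 l : R) :
  (forall x y, x <= x1 -> closed_at P Q x y) ->
  (forall x, x <= x1 -> P x 0 = P x (2 * pi)) ->
  (forall e : R, 0 < e -> exists2 x : R, x <= x1 & forall y, `|Q x y - l| <= e) ->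
  \int[@lebesgue_measure R]_(y in `[0, 2 * pi]) Q x1 y = l * (2 * pi).
Proof.
move=> cl perP lim.
have pi20 : 0 <= 2 * pi :> R by rewrite mulr_ge0// pi_ge0.
have iQ x : x <= x1 -> (@lebesgue_measure R).-integrable `[0, 2 * pi] (EFin \o Q x).
  by move=> xx; apply: integrable_continuous_itv => y _; have [] :=
      closed_at_continuous (cl x y xx).
apply/eqP; rewrite -subr_eq0 -normr_le0; apply/ler_addgt0Pl => e e0.
have [x xx1 xP] := lim (e / (2 * pi)) (divr_gt0 e0 (mulr_gt0 (ltr0Sn _ 1) (pi_gt0 R))).
have := @goursat_rectangle R P Q x x1 0 (2 * pi) xx1 pi20 (fun t y tin _ =>
  cl t y (proj2 (andP tin))).
(* By [perP] the sides [y = 0] and [y = 2 pi] cancel, so the integral of [Q] is the same at [x] as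
   at [x1]. *)
rewrite (@eq_Rintegral _ _ _ _ _ (fun=> 0)); last first.
  by move=> t /set_mem/=; rewrite in_itv => /andP[_ /perP ->]; rewrite subrr.
rewrite Rintegral_itv_cst// mul0r add0r RintegralB ?iQ// => /eqP.
rewrite subr_eq0 => /eqP ->.
have := @Rintegral_dist_cst R (Q x) 0 (2 * pi) l (e / (2 * pi)) pi20 (iQ _ xx1)
  (fun y _ => xP y).
by rewrite subr0 addr0 divfK// mulf_neq0 ?pnatr_eq0// gt_eqF ?pi_gt0.
Qed.

(** * The real modulus, complex derivatives and the exponential *)

Lemma modulusE (R : realType) (z : Cplx R) : `|z| = (modulus z)%:C%C.
Proof. by []. Qed.

Lemma modulusM (R : realType) (z w : Cplx R) :
  modulus (z * w) = modulus z * modulus w.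
Proof. exact: ComplexField.Normc.normcM. Qed.

Lemma modulusD_le (R : realType) (z w : Cplx R) :
  modulus (z + w) <= modulus z + modulus w.
Proof. exact: le_normcD. Qed.

Lemma modulusN (R : realType) (z : Cplx R) : modulus (- z) = modulus z.
Proof. exact: normcN. Qed.

Lemma modulus_ge0 (R : realType) (z : Cplx R) : 0 <= modulus z.
Proof. by case: z => a b; exact: sqrtr_ge0. Qed.

Lemma modulus0 (R : realType) : modulus (0 : Cplx R) = 0.
Proof. exact: ComplexField.Normc.normc0. Qed.

Lemma sqr_modulus (R : realType) (z : Cplx R) :
  modulus z ^+ 2 = complex.Re z ^+ 2 + complex.Im z ^+ 2.
Proof. by case: z => a b; rewrite /modulus /= sqr_sqrtr// addr_ge0 ?sqr_ge0. Qed.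

Lemma Re_le_modulus (R : realType) (z : Cplx R) :
  `|complex.Re z| <= modulus z.
Proof.
rewrite -(@ler_pXn2r _ 2) ?nnegrE ?modulus_ge0// sqr_modulus real_normK ?num_real//.
by rewrite lerDl sqr_ge0.
Qed.

Lemma Im_le_modulus (R : realType) (z : Cplx R) :
  `|complex.Im z| <= modulus z.
Proof.
rewrite -(@ler_pXn2r _ 2) ?nnegrE ?modulus_ge0// sqr_modulus real_normK ?num_real//.
by rewrite lerDr sqr_ge0.
Qed.

Lemma modulus_le (R : realType) (z : Cplx R) :
  modulus z <= `|complex.Re z| + `|complex.Im z|.
Proof.
rewrite -(@ler_pXn2r _ 2) ?nnegrE ?modulus_ge0 ?addr_ge0// sqr_modulus.
rewrite sqrrD !real_normK ?num_real// addrAC lerDl.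
by rewrite mulrn_wge0// mulr_ge0.
Qed.

(** A positive element of [R[i]] has zero imaginary part, so the balls of [R[i]] are exactly those
    with a real radius. All later estimates can then be made in [R]. *)
Lemma nbhs_modulusP (R : realType) (z : Cplx R) (A : set (Cplx R)) :
  nbhs z A <-> exists2 d : R, 0 < d & forall w, modulus (w - z) < d -> A w.
Proof.
split.
- move=> /nbhs_ballP[e /= e0 eA].
  move: e0; rewrite ltcE/= => /andP[/eqP im0 re0].
  exists (complex.Re e) => // w wz; apply: eA.
  rewrite /ball/= distrC modulusE ltcE/= im0 eqxx/=.
  exact: wz.
- move=> [d d0 dA]; apply/nbhs_ballP; exists (d%:C)%C => /=; first by rewrite ltcR.
  move=> w; rewrite /ball/= distrC modulusE ltcR; exact: dA.
Qed.

Lemma derivable_modulus (R : realType) (K : Cplx R -> Cplx R) (w : Cplx R) :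
  derivable K w 1 -> forall e : R, 0 < e -> exists2 d : R, 0 < d &
    forall w' : Cplx R, modulus (w' - w) < d ->
      modulus (K w' - K w - 'D_1 K w * (w' - w)) <= e * modulus (w' - w).
Proof.
move=> dK e e0.
have /cvgrPdist_le/(_ (e%:C)%C) : (fun h : Cplx R => h^-1 *: ((K \o shift w) (h *: 1) -
    K w))
  @ 0^' --> 'D_1 K w by exact: dK.
rewrite ltcR => /(_ e0)/nbhs_modulusP[d d0 dP]; exists d => // w' w'd.
have [->|w'w] := eqVneq w' w; first by rewrite !subrr mulr0 subrr modulus0 mulr0.
have h0 : w' - w != 0 by rewrite subr_eq0.
have := dP (w' - w); rewrite subr0 => /(_ w'd h0).
rewrite modulusE lecR /= [_ *: 1]mulr1 subrK => H.
rewrite (_ : K w' - K w - 'D_1 K w * (w' - w) =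
  - ('D_1 K w - (w' - w)^-1 *: (K w' - K w)) * (w' - w)); last first.
  by rewrite -[_ *: (_ - _)]/(_ * _); field.
by rewrite modulusM modulusN ler_wpM2r// modulus_ge0.
Qed.

Lemma is_derive_modulus (R : realType) (K : Cplx R -> Cplx R) (w k : Cplx R) :
  (forall e : R, 0 < e -> exists2 d : R, 0 < d &
    forall h : Cplx R, modulus h < d ->
      modulus (K (w + h) - K w - k * h) <= e * modulus h) ->
  is_derive w 1 K k.
Proof.
move=> H.
suff cv : (fun h : Cplx R => h^-1 *: ((K \o shift w) (h *: 1) - K w)) @ 0^' --> k.
  have dK : derivable K w 1 by apply/cvg_ex; exists k.
  split; first exact: dK.
  exact: (cvg_lim (@norm_hausdorff _ _) cv).
apply/cvgrPdist_le => e e0; have [im0 re0] : complex.Im e = 0 /\ 0 < complex.Re e.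
  by move: e0; rewrite ltcE/= => /andP[/eqP].
have [d d0 dP] := H _ re0; apply/nbhs_modulusP; exists d => // h.
rewrite subr0 => hd h0; have := dP h hd.
rewrite modulusE /= [_ *: 1]mulr1 [h + w]addrC lecE/= im0 eqxx/= => E.
have hm : 0 < modulus h.
  rewrite lt_def modulus_ge0 andbT; apply: contra h0 => /eqP h0.
  by apply/eqP; exact: ComplexField.Normc.eq0_normc.
rewrite -(ler_pM2r hm); apply: le_trans E.
rewrite -modulusM -modulusN (_ : - (_ * _) = K (w + h) - K w - k * h)//.
by rewrite -[_ *: (_ - _)]/(_ * _); field; exact: h0.
Qed.

(** With [K = u + i v], the form is the imaginary part [v dx + u dy] of [K dz]. The Cauchy-Riemann
    equations make both mixed coefficients equal to the real part of the derivative. *)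
Lemma closed_at_holomorphic (R : realType) (K : Cplx R -> Cplx R) (x y : R) :
  derivable K (x +i* y)%C 1 ->
  closed_at (fun x y => complex.Im (K (x +i* y)%C))
            (fun x y => complex.Re (K (x +i* y)%C)) x y.
Proof.
move=> dK; set w := (x +i* y)%C in dK; set k := 'D_1 K w.
exists (complex.Im k), (complex.Re k), (- complex.Im k) => e e0.
have [d d0 dP] := derivable_modulus dK e0; exists (d / 2); first by rewrite divr_gt0.
move=> x' y' x'd y'd; pose w' := (x' +i* y')%C.
have W : modulus (w' - w) <= `|x' - x| + `|y' - y| by exact: modulus_le.
have := dP w'; rewrite -/k => /(_ (le_lt_trans W _)) => H.
have {}H : modulus (K w' - K w - k * (w' - w)) <= e * (`|x' - x| + `|y' - y|).
  apply: (le_trans (H _)); first by rewrite (splitr d) ltrD.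
  by rewrite ler_wpM2l// ltW.
split.
- apply: le_trans H; apply: le_trans (Im_le_modulus _).
  rewrite le_eqVlt; apply/orP; left; apply/eqP; congr `| _ |.
  rewrite /w' /w; case: (K _) => a b; case: (K _) => a' b'; case: k => p q /=; ring.
- apply: le_trans H; apply: le_trans (Re_le_modulus _).
  rewrite le_eqVlt; apply/orP; left; apply/eqP; congr `| _ |.
  rewrite /w' /w; case: (K _) => a b; case: (K _) => a' b'; case: k => p q /=; ring.
Qed.

Lemma is_derive_norm_le (R : realType) (f : R -> R) (x k : R) :
  is_derive x 1 f k -> forall e : R, 0 < e -> exists2 d : R, 0 < d &
    forall h, `|h| < d -> `|f (x + h) - f x - k * h| <= e * `|h|.
Proof.
move=> [dK <-] e e0.
have /cvgrPdist_le/(_ _ e0)/nbhs_ballP[d /= d0 dP] :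
  (fun h => h^-1 *: ((f \o shift x) (h *: 1) - f x)) @ 0^' --> 'D_1 f x by exact: dK.
exists d => // h hd; have [->|h0] := eqVneq h 0.
  by rewrite addr0 subrr mulr0 subrr normr0 mulr0.
have := dP h; rewrite /ball/= sub0r normrN => /(_ hd h0).
rewrite [_ *: 1]mulr1 [h + x]addrC => H.
rewrite (_ : f (x + h) - f x - _ = - ('D_1 f x - h^-1 *: (f (x + h) - f x)) * h).
  by rewrite normrM normrN ler_wpM2r.
by rewrite -[_ *: (_ - _)]/(_ * _); field.
Qed.

Definition cexp (R : realType) (z : Cplx R) : Cplx R :=
  ((expR (complex.Re z) * cos (complex.Im z)) +i*
   (expR (complex.Re z) * sin (complex.Im z)))%C.

Lemma cexpD (R : realType) (z w : Cplx R) : cexp (z + w) = cexp z * cexp w.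
Proof.
case: z w => a b [c d]; rewrite /cexp /= expRD sinD cosD.
by apply/eqP; rewrite eq_complex /=; apply/andP; split; apply/eqP; ring.
Qed.

Lemma cexp0 (R : realType) : cexp (0 : Cplx R) = 1.
Proof. by rewrite /cexp /= expR0 cos0 sin0 mulr0 mulr1. Qed.

Lemma modulus_cexp (R : realType) (z : Cplx R) :
  modulus (cexp z) = expR (complex.Re z).
Proof.
apply/eqP; rewrite -(@eqrXn2 _ 2) ?modulus_ge0 ?expR_ge0// sqr_modulus /=.
by rewrite !exprMn -mulrDr cos2Dsin2 mulr1.
Qed.

Lemma cexp_expansion (R : realType) (e : R) : 0 < e -> exists2 d : R, 0 < d &
  forall h : Cplx R, modulus h < d -> modulus (cexp h - 1 - h) <= e * modulus h.
Proof.
(* The bounds [G1] and [G2] below add up to [n |a| + 7 n |b|], hence the 8. The minimum with 1 gives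
   [n <= 1], which the bounds on [expR a] require. *)
move=> e0; pose n := Num.min e 1 / 8.
have n0 : 0 < n by rewrite divr_gt0// lt_min e0/=.
have ne : 8 * n <= e by rewrite /n mulrC divfK// ge_min lexx.
have n1 : n <= 1.
  by rewrite /n ler_pdivrMr// (le_trans (_ : _ <= 1))// ?ge_min ?lexx ?orbT//; lra.
have [d1 d10 P1] := is_derive_norm_le (@is_derive_expR R 0) n0.
have [d2 d20 P2] := is_derive_norm_le (@is_derive_sin R 0) n0.
have [d3 d30 P3] := is_derive_norm_le (@is_derive_cos R 0) n0.
exists (Num.min (Num.min d1 n) (Num.min d2 d3)).
  by rewrite !lt_min d10 n0 d20.
move=> [a b]; rewrite !lt_min => /andP[/andP[h1 hn] /andP[h2 h3]].
set m := modulus _ in h1 hn h2 h3 *.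
have am : `|a| <= m by exact: (@Re_le_modulus R (a +i* b)%C).
have bm : `|b| <= m by exact: (@Im_le_modulus R (a +i* b)%C).
have := P1 a (le_lt_trans am h1); rewrite add0r expR0 mul1r => E1.
have := P2 b (le_lt_trans bm h2); rewrite add0r sin0 cos0 mul1r subr0 => E2.
have := P3 b (le_lt_trans bm h3); rewrite add0r cos0 sin0 oppr0 mul0r subr0 => E3.
have a0 := normr_ge0 a; have b0 := normr_ge0 b.
have na : n * `|a| <= `|a| by rewrite ler_piMl.
have nb : 0 <= n * `|b| by rewrite mulr_ge0// ltW.
have aa := le_lt_trans am hn.
have F1 : `|expR a - 1| <= 2 * `|a|.
  have := ler_normD (expR a - 1 - a) a; rewrite subrK; lra.
have F2 : `|expR a| <= 3.
  have := ler_normD (expR a - 1) 1; rewrite subrK normr1; lra.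
have F3 : `|1 + a| <= 2 by have := ler_normD 1 a; rewrite normr1; lra.
apply: (le_trans (modulus_le _)) => /=.
have G1 : `|expR a * cos b - 1 - a| <= n * `|a| + 2 * (n * `|b|).
  rewrite (_ : _ - a = (expR a - 1 - a) * cos b + (1 + a) * (cos b - 1)); last by ring.
  rewrite (le_trans (ler_normD _ _))// !normrM lerD//.
    rewrite (le_trans _ E1)// ler_piMr// ler_norml cos_geN1 cos_le1//.
  by rewrite ler_pM.
have G2 : `|expR a * sin b - b| <= 5 * (n * `|b|).
  rewrite (_ : _ - b = expR a * (sin b - b) + (expR a - 1) * b); last by ring.
  rewrite (le_trans (ler_normD _ _))// !normrM.
  rewrite (_ : 5 * _ = 3 * (n * `|b|) + 2 * n * `|b|); last by ring.
  rewrite lerD//; first by rewrite ler_pM.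
  rewrite ler_wpM2r// (le_trans F1)// ler_wpM2l// ltW//.
rewrite subr0; apply: (le_trans (lerD G1 G2)).
have M1 : n * `|a| <= n * m by rewrite ler_wpM2l// ltW.
have M2 : n * `|b| <= n * m by rewrite ler_wpM2l// ltW.
have M3 : 8 * n * m <= e * m by rewrite ler_wpM2r// modulus_ge0.
by lra.
Qed.

Lemma is_derive_cexp (R : realType) (w : Cplx R) : is_derive w 1 (@cexp R) (cexp w).
Proof.
apply: is_derive_modulus => e e0.
have m0 : 0 < modulus (cexp w) by rewrite modulus_cexp expR_gt0.
have [d d0 dP] := cexp_expansion (divr_gt0 e0 m0); exists d => // h hd.
rewrite cexpD (_ : _ - cexp w * h = cexp w * (cexp h - 1 - h)); last by ring.
rewrite modulusM (le_trans (ler_wpM2l (ltW m0) (dP h hd)))//.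
by rewrite mulrA [_ * (e / _)]mulrC divfK// gt_eqF.
Qed.

(** * Slices through the origin and the circle inequality *)

Lemma derivable_slice (R : realType) (g : C2 R -> Cplx R) (z : C2 R) (t : Cplx R) :
  differentiable g (t * z.1, t * z.2) ->
  is_derive t 1 (fun s : Cplx R => g (s * z.1, s * z.2))
    ('d g (t * z.1, t * z.2) (z : C2 R)).
Proof.
move=> dg; have dv := diff_derivable (v := z) dg.
have E : (fun h : Cplx R => h^-1 *: (((fun s : Cplx R => g (s * z.1, s * z.2)) \o shift
    t) (h *: 1) - g (t * z.1, t * z.2))) =
  (fun h : Cplx R => h^-1 *: ((g \o shift (t * z.1, t * z.2)) (h *: z) - g (t * z.1, t
      * z.2))).
  apply/funext => h; congr (_ *: (g _ - _)).
  by rewrite /= [h *: 1]mulr1 !mulrDl.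
split; first by rewrite /derivable E; exact: dv.
transitivity (derive g (t * z.1, t * z.2) z); last exact: deriveE.
exact: (congr1 (fun F : Cplx R -> Cplx R => lim (F @ 0^')) E).
Qed.

(** The tangent lines of the two branches span the plane. The differential of [g] at the origin is
    linear and equals [-1] on [(0, 1)] and [1] on [(1, 0)], so it is known on every [z]. *)
Lemma slice_derive0 (R : realType) (g : C2 R -> Cplx R) (z : C2 R) :
  holomorphic2 (@bidisk R) g ->
  (forall w, unit_disk w -> on_V1 g w = - w) ->
  (forall w, unit_disk w -> on_V2 g w = w) ->
  'D_1 (fun s : Cplx R => g (s * z.1, s * z.2)) 0 = z.1 - z.2.
Proof.
move=> hg g1 g2.
have d0 (v : C2 R) : differentiable g (0 * v.1, 0 * v.2).
  by apply: hg; rewrite /bidisk/= !mul0r modulus0.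
have nd (P : Cplx R -> Prop) : (forall w, unit_disk w -> P w) -> \forall w \near (0 :
    Cplx R), P w.
  by move=> H; apply/nbhs_modulusP; exists 1 => // w; rewrite subr0 => /H.
have D1 : 'd g (0, 0) (0, 1) = -1 :> Cplx R.
  have [_] := derivable_slice (d0 (0, 1)); rewrite /= !mul0r => <-.
  rewrite (@near_eq_derive _ _ _ _ (fun s : Cplx R => - s)).
    by rewrite deriveN// derive_id.
  by apply: nd => w /g1; rewrite /on_V1 mulr0 mulr1.
have D2 : 'd g (0, 0) (1, 0) = 1 :> Cplx R.
  have [_] := derivable_slice (d0 (1, 0)); rewrite /= !mul0r => <-.
  rewrite (@near_eq_derive _ _ _ _ (fun s : Cplx R => s)); first by rewrite derive_id.
  by apply: nd => w /g2; rewrite /on_V2 mulr0 mulr1.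
have [_ ->] := derivable_slice (d0 z); rewrite !mul0r.
have -> : z = (z.1 : Cplx R) *: ((1, 0) : C2 R) + (z.2 : Cplx R) *: ((0, 1) : C2 R).
  case: z => a b /=; congr pair.
    by rewrite /= [_ *: 1]mulr1 [_ *: 0]mulr0 addr0.
  by rewrite /= [_ *: 1]mulr1 [_ *: 0]mulr0 add0r.
rewrite linearD !linearZ /= D1 D2 [_ *: 1]mulr1 [_ *: -1]mulrN1.
by rewrite !scaler0 addr0 add0r [_ *: 1]mulr1.
Qed.

Lemma sqr_modulus_conj (R : realType) (z : Cplx R) :
  (z^*)%C * z = ((modulus z ^+ 2)%:C)%C.
Proof.
case: z => a b; rewrite sqr_modulus /=.
by apply/eqP; rewrite eq_complex /=; apply/andP; split; apply/eqP; ring.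
Qed.

(** The function [K w], equal to [g (e^w z) e^{-w}] times the conjugate of [D = z1 - z2], is
    holomorphic for [Re w <= 0]. As [Re w] tends to [-oo], the quotient [g (t z) / t] with [t = e^w]
    tends to the derivative [D] of the slice. The conjugate factor makes the limit the real number
    [|D|^2], so real parts suffice. *)
Lemma circle_mean (R : realType) (g : C2 R -> Cplx R) (z : C2 R) :
  holomorphic2 (@bidisk R) g ->
  (forall w, unit_disk w -> on_V1 g w = - w) ->
  (forall w, unit_disk w -> on_V2 g w = w) -> bidisk z ->
  \int[@lebesgue_measure R]_(y in `[0, 2 * pi])
    complex.Re (((z.1 - z.2)^*)%C * (g (cexp (0 +i* y)%C * z.1, cexp (0 +i* y)%C * z.2) *
       cexp (- (0 +i* y)%C))) = modulus (z.1 - z.2) ^+ 2 * (2 * pi).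
Proof.
move=> hg g1 g2 [z1 z2]; set D := z.1 - z.2.
pose G (t : Cplx R) : Cplx R := g (t * z.1, t * z.2).
pose K (w : Cplx R) : Cplx R := (D^*)%C * (G (cexp w) * cexp (- w)).
have inb (t : Cplx R) : modulus t <= 1 -> bidisk (t * z.1, t * z.2).
  by move=> t1; split => /=; rewrite modulusM;
    [apply: le_lt_trans z1|apply: le_lt_trans z2]; rewrite ler_piMl// modulus_ge0.
have dK (x y : R) : x <= 0 -> derivable K (x +i* y)%C 1.
  move=> x0; pose w : Cplx R := (x +i* y)%C; rewrite -/w.
  have dG : differentiable G (cexp w).
    apply/derivable1_diffP; have [] // := @derivable_slice R g z (cexp w).
    by apply/hg/inb; rewrite modulus_cexp -expR0 ler_expR.
  have dC (v : Cplx R) : differentiable (@cexp R) v.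
    by apply/derivable1_diffP; have [] := is_derive_cexp v.
  have d1 : derivable (G \o @cexp R) w 1.
    exact: (proj2 (derivable1_diffP _ _) (differentiable_comp (dC w) dG)).
  have dN : differentiable (fun v : Cplx R => - v : Cplx R) w.
    by apply/derivable1_diffP; apply: derivableN; exact: derivable_id.
  have d2 : derivable (@cexp R \o (fun v : Cplx R => - v : Cplx R)) w 1.
    exact: (proj2 (derivable1_diffP _ _) (differentiable_comp dN (dC (- w)))).
  have d3 := derivableM d1 d2.
  by have [] := is_deriveZ ((D^*)%C : Cplx R) (derivableP d3).
have := @mean_value_circle R _ _ 0 (modulus D ^+ 2) (fun x y x0 =>
    closed_at_holomorphic (dK x y x0)).
apply.
- have s2 : sin (2 * pi) = 0 :> R by rewrite mulr_natl sin2pi.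
  have c2 : cos (2 * pi) = 1 :> R by rewrite mulr_natl cos2pi.
  by move=> x _; rewrite /K /cexp /= !sinN !cosN s2 c2 sin0 cos0.
(* The final error is [|D|] times the error of the slice; [D] may vanish, hence [|D| + 1] as
   divisor. *)
- move=> e e0; have M0 : 0 < modulus D + 1 by rewrite ltr_wpDl// modulus_ge0.
  have dG0 : derivable G 0 1.
    have [] // := @derivable_slice R g z 0.
    by apply/hg/inb; rewrite modulus0.
  have [d d0 dP] := derivable_modulus dG0 (divr_gt0 e0 M0).
  have d20 : 0 < d / 2 by rewrite divr_gt0.
  (* This makes [|e^w| <= d / 2], within the reach of the expansion of the slice at 0. *)
  exists (Num.min 0 (ln (d / 2))) => [|y]; first by rewrite ge_min lexx.
  set x := Num.min _ _; set w := (x +i* y)%C; set t := cexp w.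
  have mt : modulus t = expR x by rewrite modulus_cexp.
  have td : modulus (t - 0) < d.
    rewrite subr0 mt (@le_lt_trans _ _ (d / 2))//; last by lra.
    by rewrite -[leRHS]lnK ?posrE// ler_expR ge_min lexx orbT.
  have tK : t * cexp (- w) = 1 by rewrite -cexpD subrr cexp0.
  have := dP _ td; rewrite (slice_derive0 z hg g1 g2) -/D subr0.
  have -> : G 0 = 0.
    have u0 : unit_disk (0 : Cplx R) by rewrite /unit_disk /mkset modulus0.
    by rewrite /G !mul0r; exact: (g2 0 u0).
  rewrite subr0 mt => H.
  have -> : modulus D ^+ 2 = complex.Re ((D^*)%C * D) by rewrite sqr_modulus_conj.
  rewrite -raddfB; apply: (le_trans (Re_le_modulus _)).
  rewrite (_ : _ - _ = (D^*)%C * (G t - D * t) * cexp (- w)); last first.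
    transitivity ((D^*)%C * (G t * cexp (- w) - D * (t * cexp (- w)))); last by ring.
    by rewrite tK mulr1 -mulrBr.
  have mDJ : modulus (D^*)%C = modulus D.
    by rewrite /modulus; case: (D) => a b /=; rewrite sqrrN.
  rewrite 2!modulusM mDJ modulus_cexp /= expRN ler_pdivrMr ?expR_gt0//.
  rewrite (le_trans (ler_wpM2l (modulus_ge0 _) H))// mulrA ler_wpM2r ?expR_ge0//.
  by rewrite mulrA ler_pdivrMr// mulrC ler_pM2l// lerDl.
Qed.

Lemma continuous_modulus (R : realType) (z : Cplx R) :
  {for z, continuous (@modulus R)}.
Proof.
apply/(@cvgrPdist_le _ _ _ (nbhs z)) => e e0; apply/nbhs_modulusP; exists e => // w wz.
rewrite ler_norml; apply/andP; split.
  rewrite lerNl opprB lerBlDr -[w in modulus w](subrK z).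
  by rewrite (le_trans (modulusD_le _ _))// lerD2r ltW.
rewrite lerBlDr -[z in modulus z](subrK w).
by rewrite (le_trans (modulusD_le _ _))// lerD2r -modulusN opprB ltW.
Qed.

Lemma continuous_Re (R : realType) (z : Cplx R) :
  {for z, continuous (fun z : Cplx R => complex.Re z)}.
Proof.
apply/(@cvgrPdist_le _ _ _ (nbhs z)) => e e0; apply/nbhs_modulusP; exists e => // w wz.
by rewrite -raddfB (le_trans (Re_le_modulus _))// -modulusN opprB ltW.
Qed.

Lemma continuous_to_C (R : realType) : continuous (@to_C R).
Proof.
move=> [a b] A /nbhs_modulusP[d d0 dA].
apply/nbhs_ballP; exists (d / 2); first by rewrite /= divr_gt0.
move=> [x y] [/= xa yb]; apply: dA; apply: (le_lt_trans (modulus_le _)) => /=.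
by rewrite (splitr d) distrC [in X in _ + X < _]distrC ltrD.
Qed.

Lemma continuous_to_C2 (R : realType) : continuous (@to_C2 R).
Proof.
move=> q; apply: (@cvg_pair _ _ _ (nbhs q) (nbhs (to_C q.1)) (nbhs (to_C q.2))).
  exact: (cvg_comp fst (@to_C R) cvg_fst (@continuous_to_C R q.1)).
exact: (cvg_comp snd (@to_C R) cvg_snd (@continuous_to_C R q.2)).
Qed.

Lemma continuous_cexp_imag (R : realType) :
  continuous (fun y : R => cexp (0 +i* y)%C).
Proof.
move=> y; have c1 : {for (0 +i* y)%C, continuous (@cexp R)}.
  have [d _] := is_derive_cexp (0 +i* y)%C.
  by apply: differentiable_continuous; exact/derivable1_diffP.
have c2 : {for y, continuous (fun y : R => (0 +i* y)%C : Cplx R)}.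
  move=> A /nbhs_modulusP[d d0 dA].
  apply/nbhs_ballP; exists d => // x xy; apply: dA.
  by apply: (le_lt_trans (modulus_le _)); rewrite /= subrr normr0 add0r distrC.
exact: (cvg_comp _ _ c2 c1).
Qed.

(** Integrate [2 Re (conj D * G * E) <= |D|^2 + |G|^2], where [|E| = 1]. By [circle_mean] the left
    side gives [2 |D|^2 * 2 pi], and one copy cancels against the right side. *)
Lemma circle_inequality (R : realType) (g : C2 R -> Cplx R) (z : C2 R) :
  holomorphic2 (@bidisk R) g ->
  (forall w, unit_disk w -> on_V1 g w = - w) ->
  (forall w, unit_disk w -> on_V2 g w = w) -> bidisk z ->
  ((modulus (z.1 - z.2) ^+ 2 * (2 * pi))%:E <=
   \int[@lebesgue_measure R]_(y in `[0%R, (2 * pi)%R])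
     (modulus (g (cexp (0 +i* y)%C * z.1, cexp (0 +i* y)%C * z.2)) ^+ 2)%:E)%E.
Proof.
move=> hg g1 g2 zb; have mean := circle_mean hg g1 g2 zb.
set D := z.1 - z.2 in mean *.
pose G (y : R) : Cplx R := g (cexp (0 +i* y)%C * z.1, cexp (0 +i* y)%C * z.2).
pose E (y : R) : Cplx R := cexp (- (0 +i* y)%C).
have me (y : R) : modulus (cexp (0 +i* y)%C) = 1 by rewrite modulus_cexp expR0.
have mE (y : R) : modulus (E y) = 1 by rewrite modulus_cexp /= oppr0 expR0.
have cG (y : R) : {for y, continuous G}.
  have ce := @continuous_cexp_imag R y.
  have c1 : {for y, continuous (fun y : R => (cexp (0 +i* y)%C * z.1, cexp (0 +i* y)%C
      * z.2) : C2 R)}.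
    apply: (@cvg_pair _ _ _ (nbhs y) (nbhs (cexp (0 +i* y)%C * z.1)) (nbhs (cexp (0 +i*
        y)%C * z.2)));
      by apply: cvgM; [exact: ce|exact: cvg_cst].
  have c2 : {for (cexp (0 +i* y)%C * z.1, cexp (0 +i* y)%C * z.2), continuous g}.
    apply: differentiable_continuous; apply: hg.
    by case: zb => z1 z2; split; rewrite /= modulusM me mul1r.
  exact: (cvg_comp _ g c1 c2).
have cE (y : R) : {for y, continuous E}.
  have c1 := @continuous_cexp_imag R (- y).
  have c2 : {for y, continuous (fun y : R => - y)} by apply: cvgN; exact: cvg_id.
  have -> : E = (fun y : R => cexp (0 +i* y)%C) \o (fun y : R => - y).
    by apply/funext => t; rewrite /E /cexp /= oppr0.
  exact: (cvg_comp _ _ c2 c1).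
have iG : (@lebesgue_measure R).-integrable `[0, 2 * pi]
    (EFin \o (fun y => modulus (G y) ^+ 2)).
  apply: integrable_continuous_itv => y _.
  have c := cvg_comp _ _ (cG y) (@continuous_modulus R (G y)).
  by apply: cvgM; exact: c.
pose F y := complex.Re ((D^*)%C * (G y * E y)).
have iF : (@lebesgue_measure R).-integrable `[0, 2 * pi] (EFin \o F).
  apply: integrable_continuous_itv => y _.
  have c : {for y, continuous (fun y => (D^*)%C * (G y * E y) : Cplx R)}.
    apply: cvgM; first exact: cvg_cst.
    by apply: cvgM; [exact: cG|exact: cE].
  exact: (cvg_comp _ _ c (@continuous_Re R _)).
have pi20 : 0 <= 2 * pi :> R by rewrite mulr_ge0// pi_ge0.
have iD (k : R) : (@lebesgue_measure R).-integrable `[0, 2 * pi] (EFin \o (fun=> k)).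
  by apply: integrable_continuous_itv => y _; exact: cvg_cst.
have := @le_Rintegral _ _ _ (@lebesgue_measure R) `[0, 2 * pi]
  (fun y => F y + F y) (fun y => modulus D ^+ 2 + modulus (G y) ^+ 2)
  (measurable_itv _) (integrableD _ iF iF) (integrableD _ (iD (modulus D ^+ 2)) iG).
have ptw y : F y + F y <= modulus D ^+ 2 + modulus (G y) ^+ 2.
  have mDJ : modulus (D^*)%C = modulus D.
    by rewrite /modulus; case: (D) => a b /=; rewrite sqrrN.
  have : F y <= modulus D * modulus (G y).
    rewrite (le_trans (ler_norm _))// (le_trans (Re_le_modulus _))//.
    by rewrite !modulusM mDJ mE mulr1.
  have : 0 <= (modulus D - modulus (G y)) ^+ 2 by exact: sqr_ge0.
  by nra.
move=> /(_ (measurable_itv _) (measurable_itv _) (fun y _ => ptw y)); rewrite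
    !RintegralD// Rintegral_itv_cst// subr0 => K.
have {}mean : \int[@lebesgue_measure R]_(y in `[0, 2 * pi]) F y = modulus D ^+ 2 * (2 *
    pi) by [].
rewrite mean lerD2l in K; move: K.
by rewrite /Rintegral -lee_fin fineK//; exact: integrable_fin_num.
Qed.

(** * The sub-mean value inequality for [ln (|a + b e^{it}|^2 + e)] *)

Lemma Rintegral_affine (R : realType) (G : R -> R) (a b k c : R) :
  a <= b -> 0 < k -> continuous G ->
  \int[@lebesgue_measure R]_(x in `[k * a + c, k * b + c]) G x =
  k * \int[@lebesgue_measure R]_(x in `[a, b]) G (k * x + c).
Proof.
move=> ab k0 cG; pose F x := k * x + c.
have dF (x : R) : is_derive x 1 F k.
  have := is_deriveD (is_deriveZ k (is_derive_id x 1)) (is_derive_cst c x 1).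
  by rewrite addr0 [_ *: 1]mulr1.
have cF : continuous F.
  move=> x; apply: differentiable_continuous; apply/derivable1_diffP.
  by have [] := dF x.
have dFE : derive1 F = cst k by apply/funext => x; rewrite derive1E; have [_ ->] := dF x.
have := @integration_by_substitution_increasing R F G a b ab.
rewrite dFE => /(_ _ _ _ _ _ _)/wrap[].
- by move=> x y _ _ xy; rewrite /F ltrD2r ltr_pM2l.
- by move=> x _; exact: cvg_cst.
- exact: is_cvg_cst.
- exact: is_cvg_cst.
- split.
  + by move=> x _; have [] := dF x.
  + by apply: cvg_at_right_filter; exact: cF.
  + by apply: cvg_at_left_filter; exact: cF.
- by apply: continuous_subspaceT.
rewrite /Rintegral => ->.
have iG : (@lebesgue_measure R).-integrable `[a, b] (EFin \o (G \o F)).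
  by apply: integrable_continuous_itv => x _; exact: (cvg_comp _ _ (cF x) (cG (F x))).
rewrite -/(Rintegral _ _ _) -RintegralZl//.
by apply: eq_Rintegral => x _; rewrite mulrC.
Qed.

(** The shape of [|a + b e^{it}|^2 + e] as a function of [t]. Products of values at [t] and [t + pi]
    have this shape again, in the variable [2 t]. *)
Definition trig_lin (R : realType) (A X Y t : R) := A + X * cos t + Y * sin t.

(** The function is [|1 + c e^{it}|^2] for some [c] of modulus [r]. The proof bounds its oscillating
    part by Cauchy-Schwarz. *)
Lemma trig_lin_ge (R : realType) (r X Y t : R) : 0 <= r -> r < 1 ->
  X ^+ 2 + Y ^+ 2 = 4 * r ^+ 2 -> (1 - r) ^+ 2 <= trig_lin (1 + r ^+ 2) X Y t.
Proof.
move=> r0 r1 XY.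
have cs := cos2Dsin2 t.
have K : (X * cos t + Y * sin t) ^+ 2 <= (2 * r) ^+ 2.
  rewrite exprMn (_ : 2 ^+ 2 = 4); last by ring.
  rewrite -XY -[leRHS]mulr1 -cs -subr_ge0.
  rewrite (_ : _ - _ = (X * sin t - Y * cos t) ^+ 2); first exact: sqr_ge0.
  ring.
have r20 : 0 <= 2 * r by rewrite mulr_ge0.
have : `|X * cos t + Y * sin t| <= 2 * r.
  rewrite -(ger0_norm r20) -(@ler_pXn2r _ 2) ?nnegrE//.
  by rewrite !real_normK ?num_real.
rewrite ler_norml => /andP[h _].
rewrite /trig_lin sqrrB expr1n mul1r -addrA -mulr_natl.
lra.
Qed.

Lemma trig_lin_continuous (R : realType) (A X Y : R) : continuous (trig_lin A X Y).
Proof.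
move=> t; apply: cvgD; first apply: cvgD; first exact: cvg_cst.
  by apply: cvgM; [exact: cvg_cst|exact: continuous_cos].
by apply: cvgM; [exact: cvg_cst|exact: continuous_sin].
Qed.

Lemma ln_trig_lin_continuous (R : realType) (A X Y : R) :
  (forall t, 0 < trig_lin A X Y t) -> continuous (fun t => ln (trig_lin A X Y t)).
Proof.
move=> N0 t.
exact: (cvg_comp _ _ (@trig_lin_continuous R A X Y t) (continuous_ln (N0 t))).
Qed.

(** Adding [pi] to [t] changes the sign of the oscillating part [u], and
    [(A + u) (A - u) = A^2 - u^2] depends on [2 t] only. Folding the circle in two and rescaling
    gives the factor [2^-1]. *)
Lemma ln_trig_lin_double (R : realType) (A X Y : R) :
  (forall t, 0 < trig_lin A X Y t) ->
  \int[@lebesgue_measure R]_(t in `[0, 2 * pi]) ln (trig_lin A X Y t) =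
  2^-1 * \int[@lebesgue_measure R]_(t in `[0, 2 * pi])
    ln (trig_lin (A ^+ 2 - (X ^+ 2 + Y ^+ 2) / 2) (- ((X ^+ 2 - Y ^+ 2) / 2)) (- (X *
        Y)) t).
Proof.
move=> N0; set A' := _ - _; set X' := - (_ / 2); set Y' := - (X * Y).
have E t : trig_lin A X Y t * trig_lin A X Y (t + pi) = trig_lin A' X' Y' (2 * t + 0).
  rewrite addr0 mulr_natl mulr2n /trig_lin cosDpi sinDpi cosD sinD /A' /X' /Y'.
  have cs : sin t ^+ 2 = 1 - cos t ^+ 2 by rewrite -(cos2Dsin2 t) addrAC subrr add0r.
  have -> : sin t * sin t = 1 - cos t ^+ 2 by rewrite -expr2.
  rewrite (_ : (A + _ + _) * _ = A ^+ 2 - X ^+ 2 * cos t ^+ 2 - Y ^+ 2 * sin t ^+ 2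
     - 2 * (X * Y) * (sin t * cos t)); last by ring.
  by rewrite cs; field.
have N0' t : 0 < trig_lin A' X' Y' t.
  have -> : t = 2 * (t / 2) + 0 by rewrite addr0 mulrC divfK.
  by rewrite -E mulr_gt0.
have pi0 : 0 <= pi :> R := pi_ge0 R.
have c1 := ln_trig_lin_continuous N0; have c2 := ln_trig_lin_continuous N0'.
have i1 a b : (@lebesgue_measure R).-integrable `[a, b] (EFin \o (fun t => ln (trig_lin
    A X Y t))).
  by apply: integrable_continuous_itv => t _; exact: c1.
have pi2 : pi <= 2 * pi :> R by lra.
rewrite (Rintegral_itv_cat pi0 pi2)//.
have := @Rintegral_affine R _ 0 pi 1 pi pi0 ltr01 c1.
rewrite mulr0 add0r !mul1r (_ : pi + pi = 2 * pi); last by ring.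
move=> ->.
under [in X in _ + X]eq_Rintegral do rewrite mul1r.
have := @Rintegral_affine R _ 0 pi 2 0 pi0 (ltr0Sn _ 1) c2.
rewrite mulr0 !addr0 => ->; rewrite mulKf ?pnatr_eq0//.
rewrite -RintegralD//.
  by apply: eq_Rintegral => t _; rewrite -E lnM ?posrE.
apply: integrable_continuous_itv => t _.
have ct : {for t, continuous (fun t : R => t + pi)}.
  by apply: cvgD; [exact: cvg_id|exact: cvg_cst].
exact: (cvg_comp _ _ ct (c1 (t + pi))).
Qed.

(** Each doubling replaces [r] by [r^2] and halves the integral. After [n] of them the pointwise
    bound applies, and [1 - r^2 >= 1 - r] lets the constant of the original [r] serve throughout. As
    [n] grows the bound tends to 0. *)
Lemma ln_trig_lin_ge (R : realType) (n : nat) (r X Y : R) : 0 <= r -> r < 1 ->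
  X ^+ 2 + Y ^+ 2 = 4 * r ^+ 2 ->
  ln ((1 - r) ^+ 2) * (2 * pi) / 2 ^+ n <=
  \int[@lebesgue_measure R]_(t in `[0, 2 * pi]) ln (trig_lin (1 + r ^+ 2) X Y t).
Proof.
have pi20 : 0 <= 2 * pi :> R by rewrite mulr_ge0// pi_ge0.
elim: n r X Y => [|n IH] r X Y r0 r1 XY.
  have q0 : 0 < (1 - r) ^+ 2 by rewrite exprn_gt0// subr_gt0.
  have N0 t := lt_le_trans q0 (trig_lin_ge t r0 r1 XY).
  rewrite expr0 divr1 -[in leLHS](subr0 (2 * pi)) -Rintegral_itv_cst//.
  apply: le_Rintegral => //.
  - by apply: integrable_continuous_itv => t _; exact: cvg_cst.
  - by apply: integrable_continuous_itv => t _; exact: ln_trig_lin_continuous.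
  - by move=> t _; rewrite ler_ln ?posrE// trig_lin_ge.
have q0 : 0 < (1 - r) ^+ 2 by rewrite exprn_gt0// subr_gt0.
have N0 t := lt_le_trans q0 (trig_lin_ge t r0 r1 XY).
rewrite ln_trig_lin_double// XY.
have -> : (1 + r ^+ 2) ^+ 2 - 4 * r ^+ 2 / 2 = 1 + (r ^+ 2) ^+ 2 by field.
have r2 : r ^+ 2 < 1 by rewrite exprn_ilt1.
have r20 : 0 <= r ^+ 2 by exact: sqr_ge0.
have := IH (r ^+ 2) (- ((X ^+ 2 - Y ^+ 2) / 2)) (- (X * Y)) r20 r2.
have -> : (- ((X ^+ 2 - Y ^+ 2) / 2)) ^+ 2 + (- (X * Y)) ^+ 2 = 4 * (r ^+ 2) ^+ 2.
  rewrite (_ : 4 * (r ^+ 2) ^+ 2 = (X ^+ 2 + Y ^+ 2) ^+ 2 / 4); last by rewrite XY; field.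
  by field.
move=> /(_ erefl) H; rewrite (exprS 2 n) invfM mulrCA ler_pM2l ?invr_gt0//.
apply: le_trans H; rewrite ler_pM2r ?invr_gt0 ?exprn_gt0// ler_wpM2r//.
rewrite ler_ln ?posrE//; last by rewrite exprn_gt0// subr_gt0.
have d1 : 0 <= 1 - r by rewrite subr_ge0 ltW.
have d2 : 0 <= 1 - r ^+ 2 by rewrite subr_ge0 ltW.
rewrite ler_pXn2r ?nnegrE// lerD2l lerN2 expr2.
by apply: ler_piMr => //; exact: ltW.
Qed.

(* The sub-mean value property of [ln (|u|^2 + e)] on the circle [a + b e^{it}],
   with [al], [be] standing for [|a|^2], [|b|^2]: for the larger root [M] of
   [M + al be / M = al + be + e], the function to integrate is
   [ln M + ln |1 + c e^{it}|^2] with [|c| < 1]. *)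
Lemma le_Rintegral_ln_trig_lin (R : realType) (al be e X Y : R) :
  0 <= al -> 0 <= be -> 0 < e -> X ^+ 2 + Y ^+ 2 = 4 * (al * be) ->
  (forall t, 0 < trig_lin (al + be + e) X Y t) /\
  2 * pi * ln (al + e) <=
  \int[@lebesgue_measure R]_(t in `[0, 2 * pi]) ln (trig_lin (al + be + e) X Y t).
Proof.
move=> al0 be0 e0 XY; set A := al + be + e; pose D := A ^+ 2 - 4 * (al * be).
have ab0 : 0 <= al * be by rewrite mulr_ge0.
have D0 : 0 < D.
  rewrite (_ : D = (al - be) ^+ 2 + (2 * e * (al + be) + e ^+ 2)); last by rewrite /D
      /A; ring.
  by rewrite ltr_wpDl ?sqr_ge0// ltr_wpDl ?exprn_gt0// !mulr_ge0 ?addr_ge0// ltW.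
pose s := Num.sqrt D; have s0 : 0 < s by rewrite sqrtr_gt0.
have s2 : s ^+ 2 = D by rewrite sqr_sqrtr// ltW.
have A0 : 0 < A by rewrite /A; lra.
pose M := (A + s) / 2; have M0 : 0 < M by rewrite /M; lra.
have eM : al + e <= M.
  have : al + e - be <= s.
    rewrite (le_trans (ler_norm _))// -(@ler_pXn2r _ 2) ?nnegrE ?(ltW s0)//.
    rewrite real_normK ?num_real// s2 -subr_ge0.
    rewrite (_ : D - _ = 4 * (e * be)); last by rewrite /D /A; ring.
    by rewrite !mulr_ge0// ltW.
  by rewrite /M /A; lra.
pose r := Num.sqrt (al * be) / M.
have r0 : 0 <= r by rewrite divr_ge0 ?sqrtr_ge0// ltW.
have r2 : r ^+ 2 = al * be / M ^+ 2 by rewrite exprMn exprVn sqr_sqrtr.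
have r1 : r < 1.
  rewrite -(@ltr_pXn2r _ 2) ?nnegrE// expr1n r2 ltr_pdivrMr ?exprn_gt0// mul1r.
  rewrite -subr_gt0 (_ : _ - _ = (D + s ^+ 2 + 2 * (A * s)) / 4); last first.
    by rewrite /M /D; field.
  by have := mulr_gt0 A0 s0; have := exprn_gt0 2 s0; lra.
have MA : M * (1 + r ^+ 2) = A.
  rewrite r2; apply: (mulfI (lt0r_neq0 M0)).
  rewrite (_ : M * (M * _) = M ^+ 2 + al * be); last by field; rewrite lt0r_neq0.
  rewrite (_ : M * A = M ^+ 2 + (A ^+ 2 - s ^+ 2) / 4); last by rewrite /M; field.
  by rewrite s2 /D; field.
have XYr : (X / M) ^+ 2 + (Y / M) ^+ 2 = 4 * r ^+ 2.
  by rewrite r2 mulrA -XY; field; rewrite lt0r_neq0.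
have N0 t : 0 < trig_lin (1 + r ^+ 2) (X / M) (Y / M) t.
  apply: lt_le_trans (trig_lin_ge t r0 r1 XYr).
  by rewrite exprn_gt0// subr_gt0.
have E t : trig_lin A X Y t = M * trig_lin (1 + r ^+ 2) (X / M) (Y / M) t.
  by rewrite /trig_lin -{1}MA; field; rewrite lt0r_neq0.
have pi20 : 0 <= 2 * pi :> R by rewrite mulr_ge0// pi_ge0.
split; first by move=> t; rewrite E mulr_gt0.
under eq_Rintegral do rewrite E lnM ?posrE//.
rewrite RintegralD//; last 2 first.
- by apply: integrable_continuous_itv => t _; exact: cvg_cst.
- by apply: integrable_continuous_itv => t _; exact: ln_trig_lin_continuous.
rewrite Rintegral_itv_cst// subr0 mulrC -[leLHS]addr0 lerD//.
  by rewrite ler_wpM2r// ler_ln ?posrE//; lra.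
(* A negative integral would eventually lie below the lower bounds [c / 2 ^+ n], which tend to 0. *)
rewrite leNgt; apply/negP; set I := Rintegral _ _ _ => I0.
pose c := ln ((1 - r) ^+ 2) * (2 * pi).
have Ic n : c / 2 ^+ n <= I by exact: ln_trig_lin_ge.
have [N _ /(_ N (leqnn N))] : \forall n \near \oo, I < c / 2 ^+ n.
  have : (fun n => c / 2 ^+ n) @ \oo --> (0 : R).
    rewrite -(mulr0 c); apply: cvgMr.
    under eq_fun do rewrite -exprVn.
    by apply: cvg_expr; rewrite ger0_norm ?invr_ge0// invf_lt1 ?ltr1n.
  by move/cvgr_gt; exact.
by rewrite /= ltNge Ic.
Qed.

(** * The weight and its plurisubharmonicity *)

Definition wden (R : realType) (e : R) (z : C2 R) : R :=
  modulus (z.1 + z.2) ^+ 2 + e ^+ 2.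

Definition weight (R : realType) (e : R) (z : C2 R) : \bar R :=
  (ln (wden e z))%:E.

Lemma wden_gt0 (R : realType) (e : R) (z : C2 R) : 0 < e -> 0 < wden e z.
Proof. by move=> e0; rewrite ltr_wpDl ?sqr_ge0// exprn_gt0. Qed.

Lemma continuous_wden (R : realType) (e : R) (z : C2 R) :
  {for z, continuous (wden e)}.
Proof.
have c1 : {for z, continuous (fun z : C2 R => z.1 + z.2 : Cplx R)}.
  by apply: cvgD; [exact: cvg_fst|exact: cvg_snd].
have c2 := cvg_comp _ _ c1 (@continuous_modulus R (z.1 + z.2)).
by apply: cvgD; [apply: cvgM; exact: c2|exact: cvg_cst].
Qed.

Lemma psh_weight (R : realType) (e : R) : 0 < e -> psh (@bidisk R) (weight e).
Proof.
move=> e0; split.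
- by move=> z _; exact: ltry.
- exists (0, 0); last exact: ltNyr.
  by have m0 : modulus (0 : Cplx R) < 1 by [rewrite modulus0]; split; exact: m0.
- move=> z _ c; rewrite lte_fin => zc.
  have : {for z, continuous (fun z : C2 R => ln (wden e z))}.
    exact: (cvg_comp _ _ (@continuous_wden R e z) (continuous_ln (wden_gt0 z e0))).
  move/cvgr_lt => /(_ _ zc); apply: filterS => w wc _.
  by rewrite lte_fin.
- move=> a b _; pose u := a.1 + a.2; pose v := b.1 + b.2.
  (* [p] and [q] are the real and imaginary parts of [u] times the conjugate of [v], so that [|u +
     e^{it} v|^2 = |u|^2 + |v|^2 + 2 p cos t + 2 q sin t]. *)
  pose p := complex.Re u * complex.Re v + complex.Im u * complex.Im v.
  pose q := complex.Im u * complex.Re v - complex.Re u * complex.Im v.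
  have XY : (2 * p) ^+ 2 + (2 * q) ^+ 2 = 4 * (modulus u ^+ 2 * modulus v ^+ 2).
    by rewrite !sqr_modulus /p /q; ring.
  have [N0 H] := le_Rintegral_ln_trig_lin (sqr_ge0 _) (sqr_ge0 _) (exprn_gt0 2 e0) XY.
  have E t : weight e (on_line a b (cos t +i* sin t)%C) =
      (ln (trig_lin (modulus u ^+ 2 + modulus v ^+ 2 + e ^+ 2) (2 * p) (2 * q) t))%:E.
    congr (ln _)%:E; rewrite /wden /on_line /=.
    have -> : a.1 + (cos t +i* sin t)%C * b.1 + (a.2 + (cos t +i* sin t)%C * b.2) =
      u + (cos t +i* sin t)%C * v by rewrite /u /v mulrDr addrACA.
    rewrite !sqr_modulus /trig_lin /p /q.
    have cs : sin t ^+ 2 = 1 - cos t ^+ 2 by rewrite -(cos2Dsin2 t) addrAC subrr add0r.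
    case: u {p q XY N0 H} => u1 u2; case: v => v1 v2 /=.
    transitivity (u1 ^+ 2 + u2 ^+ 2 + (v1 ^+ 2 + v2 ^+ 2) * (cos t ^+ 2 + sin t ^+ 2)
      + 2 * (u1 * v1 + u2 * v2) * cos t + 2 * (u2 * v1 - u1 * v2) * sin t + e ^+ 2);
          first by ring.
    by rewrite cs; ring.
  under eq_integral do rewrite E.
  have iN : (@lebesgue_measure R).-integrable `[0, 2 * pi] (EFin \o (fun t =>
      ln (trig_lin (modulus u ^+ 2 + modulus v ^+ 2 + e ^+ 2) (2 * p) (2 * q) t))).
    by apply: integrable_continuous_itv => t _; exact: ln_trig_lin_continuous.
  move: H; rewrite /Rintegral -lee_fin fineK//; exact: integrable_fin_num.
Qed.

(** * Integral-preserving maps: translations, shears, rotations, products *)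

(** The image of Lebesgue measure under a translation gives each half-open interval its length, and
    this determines the measure. *)
Lemma ge0_integral_translate (R : realType) (f : R -> \bar R) (c : R) :
  measurable_fun [set: R] f -> (forall x, (0 <= f x)%E) ->
  (\int[@lebesgue_measure R]_x f (x + c)%R = \int[@lebesgue_measure R]_x f x)%E.
Proof.
move=> mf f0; pose phi : measurableTypeR R -> measurableTypeR R := fun x : R => x + c.
have mphi : measurable_fun [set: measurableTypeR R] phi.
  by apply: (@measurable_funD _ R R setT id (cst c)); [exact: measurable_id|exact:
      measurable_cst].
have := @ge0_integral_pushforward _ _ _ _ R phi mphi lebesgue_measure [set: R] f
  measurableT mf (fun y _ => f0 y).
rewrite preimage_setT => <-.
apply: eq_measure_integral => //= A mA _; apply/esym/lebesgue_measure_unique => //= _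
    [[a b]] _ <-.
rewrite /pushforward (_ : phi @^-1` _ = `]a - c, b - c]%classic); last first.
  by apply/seteqP; split=> x /=; rewrite !in_itv /= /phi ltrBlDr lerBrDr.
rewrite !lebesgue_measure_itv/= !lte_fin ltrD2r.
by case: ifP => // _; rewrite -!EFinB opprD addrACA subrr addr0.
Qed.


Lemma product_sigma_finite (d1 d2 : measure_display) (T1 : measurableType d1)
    (T2 : measurableType d2) (R : realType)
    (m1 : {sigma_finite_measure set T1 -> \bar R})
    (m2 : {sigma_finite_measure set T2 -> \bar R}) :
  sigma_finite [set: T1 * T2] (m1 \x m2)%E.
Proof.
have /sigma_finiteP[F [TF ndF Foo]] := sigma_finiteT m1.
have /sigma_finiteP[G [TG ndG Goo]] := sigma_finiteT m2.
exists (fun n => F n `*` G n); last first.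
  move=> k; have [mF F0] := Foo k; have [mG G0] := Goo k.
  split; first exact: measurableX.
  by rewrite product_measure1E// lte_mul_pinfty// ge0_fin_numE.
rewrite -setXTT TF TG predeqE => -[x y]; split.
  move=> [/= [n _ Fnx] [k _ Gky]]; exists (maxn n k) => //; split.
  - by move: x Fnx; exact/subsetPset/ndF/leq_maxl.
  - by move: y Gky; exact/subsetPset/ndG/leq_maxr.
by move=> [n _ []/= Fx Gy]; split; exists n.
Qed.

(* Canonical inference on [m1 \x m2] picks the instance for subprobabilities,
   hence this explicit packaging. *)
Definition product_sf (d1 d2 : measure_display) (T1 : measurableType d1)
    (T2 : measurableType d2) (R : realType)
    (m1 : {sigma_finite_measure set T1 -> \bar R})
    (m2 : {sigma_finite_measure set T2 -> \bar R}) :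
    {sigma_finite_measure set (T1 * T2)%type -> \bar R} :=
  HB.pack (m1 \x m2)%E
    (Measure_isSigmaFinite.Build _ _ _ (m1 \x m2)%E (product_sigma_finite m1 m2)).

(** Stated for nonnegative integrals rather than for preimages of sets, so that it can be applied
    inside an iterated integral. *)
Definition integral_preserving (d : measure_display) (X : measurableType d)
    (R : realType) (m : set X -> \bar R) (T : X -> X) :=
  measurable_fun [set: X] T /\
  forall f : X -> \bar R, measurable_fun [set: X] f ->
    (forall p, (0 <= f p)%E) -> (\int[m]_p f (T p) = \int[m]_p f p)%E.

Lemma integral_preserving_comp (d : measure_display) (X : measurableType d)
    (R : realType) (m : set X -> \bar R) (T S : X -> X) :
  integral_preserving m T -> integral_preserving m S ->
  integral_preserving m (T \o S).
Proof.
move=> [mT iT] [mS iS]; split; first exact: measurableT_comp.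
move=> f mf f0; rewrite -(iT f mf f0).
exact: (iS (f \o T) (measurableT_comp mf mT) (fun p => f0 (T p))).
Qed.

(** By Tonelli: invariance is used in the inner variable, then for the inner integral as a function
    of the outer variable. *)
Lemma integral_preserving_prod (d : measure_display) (X : measurableType d)
    (R : realType) (m : {sigma_finite_measure set X -> \bar R}) (T : X -> X) :
  integral_preserving m T ->
  integral_preserving (m \x m)%E (fun q : X * X => (T q.1, T q.2)).
Proof.
move=> [mT iT].
have mT2 : measurable_fun [set: X * X] (fun q => (T q.1, T q.2)).
  apply/measurable_fun_pairP; split => /=.
    exact: (measurableT_comp mT measurable_fst).
  exact: (measurableT_comp mT measurable_snd).
split => // f mf f0.
have mfT := measurableT_comp mf mT2.
rewrite (fubini_tonelli1 (f \o (fun q => (T q.1, T q.2))) mfT (fun q => f0 _)).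
rewrite (fubini_tonelli1 f mf f0).
have mF := measurable_fun_fubini_tonelli_F f (m2 := m) mf f0.
rewrite -(iT _ mF); last by move=> p; apply: integral_ge0.
apply: eq_integral => p _; rewrite /fubini_F /=.
have mfp : measurable_fun [set: X] (fun y => f (T p, y)).
  by apply: measurableT_comp => //; exact: pair1_measurable.
exact: (iT _ mfp (fun y => f0 (T p, y))).
Qed.

Lemma integral_preserving_prod2 (d : measure_display) (X : measurableType d)
    (R : realType) (m : {sigma_finite_measure set X -> \bar R}) (T : X * X -> X * X) :
  integral_preserving (m \x m)%E T ->
  integral_preserving ((m \x m) \x (m \x m))%E
    (fun q : (X * X) * (X * X) => (T q.1, T q.2)).
Proof. exact: (@integral_preserving_prod _ _ _ (product_sf m m)). Qed.

Definition plane_preserving (R : realType) :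
    (measurableTypeR R * measurableTypeR R ->
     measurableTypeR R * measurableTypeR R) -> Prop :=
  integral_preserving (leb2 R).

(** On each horizontal line the shear is a translation. *)
Lemma plane_preserving_shear1 (R : realType) (t : R) :
  plane_preserving (fun p : measurableTypeR R * measurableTypeR R =>
    (p.1 + t * p.2, p.2)).
Proof.
have mT : measurable_fun [set: measurableTypeR R * measurableTypeR R]
    (fun p : measurableTypeR R * measurableTypeR R => (p.1 + t * p.2, p.2)).
  apply/measurable_fun_pairP; split => /=; last exact: measurable_snd.
  apply: measurable_funD; first exact: measurable_fst.
  by apply: measurable_funM; [exact: measurable_cst|exact: measurable_snd].
split=> // f mf f0.
have mfT := measurableT_comp mf mT.
rewrite (fubini_tonelli2 _ mfT (fun p => f0 _)) (fubini_tonelli2 f mf f0).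
apply: eq_integral => y _ /=.
apply: (@ge0_integral_translate R (fun x => f (x, y)) (t * y)) => //.
by apply: measurableT_comp => //; exact: pair2_measurable.
Qed.

Lemma plane_preserving_shear2 (R : realType) (t : R) :
  plane_preserving (fun p : measurableTypeR R * measurableTypeR R =>
    (p.1, p.2 + t * p.1)).
Proof.
have mT : measurable_fun [set: measurableTypeR R * measurableTypeR R]
    (fun p : measurableTypeR R * measurableTypeR R => (p.1, p.2 + t * p.1)).
  apply/measurable_fun_pairP; split => /=; first exact: measurable_fst.
  apply: measurable_funD; first exact: measurable_snd.
  by apply: measurable_funM; [exact: measurable_cst|exact: measurable_fst].
split=> // f mf f0.
have mfT := measurableT_comp mf mT.
rewrite (fubini_tonelli1 _ mfT (fun p => f0 _)) (fubini_tonelli1 f mf f0).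
apply: eq_integral => x _ /=.
apply: (@ge0_integral_translate R (fun y => f (x, y)) (t * x)) => //.
by apply: measurableT_comp => //; exact: pair1_measurable.
Qed.

Lemma plane_preserving_rotation (R : realType) (c s : R) :
  c ^+ 2 + s ^+ 2 = 1 ->
  plane_preserving (fun p : measurableTypeR R * measurableTypeR R =>
    (c * p.1 - s * p.2, s * p.1 + c * p.2)).
Proof.
(* A rotation other than [1] and [-1] is a product of three shears. *)
have shears (a b : R) : a ^+ 2 + b ^+ 2 = 1 -> b != 0 ->
    plane_preserving (fun p : measurableTypeR R * measurableTypeR R =>
      (a * p.1 - b * p.2, b * p.1 + a * p.2)).
  (* For the rotation by [theta] this is [- tan (theta / 2)]. *)
  move=> ab b0; pose t := (a - 1) / b.
  have := integral_preserving_comp (plane_preserving_shear1 t)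
    (integral_preserving_comp (plane_preserving_shear2 b) (plane_preserving_shear1 t)).
  congr plane_preserving; apply/funext => -[x y] /=.
  have tb : b * t = a - 1 by rewrite /t mulrC divfK.
  have tt : t * (1 + a) = - b.
    apply: (mulfI b0); rewrite mulrA tb mulrN -expr2.
    have -> : b ^+ 2 = 1 - a ^+ 2 by rewrite -ab addrAC subrr add0r.
    by ring.
  congr pair.
    transitivity ((1 + b * t) * x + (t * (1 + (1 + b * t))) * y); first by ring.
    by rewrite tb [1 + (a - 1)]addrC subrK tt mulNr.
  transitivity (b * x + (1 + b * t) * y); first by ring.
  by rewrite tb [1 + (a - 1)]addrC subrK.
(* A vanishing sine leaves the identity, which is a trivial shear, and the half turn, which is the
   square of the quarter turn. *)
move=> cs; have [s0|s0] := eqVneq s 0; last exact: shears.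
have r1 : 0 ^+ 2 + 1 ^+ 2 = 1 :> R by rewrite expr0n expr1n add0r.
move: cs; rewrite s0 expr0n addr0 => /eqP; rewrite sqrf_eq1 => /orP[]/eqP ->.
  have := plane_preserving_shear1 (0 : R).
  by congr plane_preserving; apply/funext => -[x y] /=; congr pair; ring.
have := integral_preserving_comp (shears 0 1 r1 (oner_neq0 R)) (shears 0 1 r1
    (oner_neq0 R)).
by congr plane_preserving; apply/funext => -[x y] /=; congr pair; ring.
Qed.

(** * Measurability of open sets in products *)

(** A countable base of measurable sets for the neighbourhoods [N]. These are a parameter because
    the structure of a measurable type carries no topology. *)
Definition measurable_base (d : measure_display) (T : measurableType d)
    (N : T -> set_system T) :=
  exists B : nat -> set T, (forall n, measurable (B n)) /\
    forall x A, N x A -> exists n, B n x /\ B n `<=` A.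

Lemma measurable_base_prod (d d' : measure_display) (T : measurableType d)
    (T' : measurableType d') (N : T -> set_system T) (N' : T' -> set_system T') :
  measurable_base N -> measurable_base N' ->
  measurable_base (fun p : T * T' => filter_prod (N p.1) (N' p.2)).
Proof.
move=> [B [mB BP]] [B' [mB' BP']].
exists (fun n => if @unpickle (nat * nat)%type n is Some (i, j) then B i `*` B' j else
    set0).
split=> [n|[x y] A [[A1 A2] /= [/BP [i [ix iA]] /BP' [j [jy jA]]] sA]].
  case: unpickle => [[i j]|]; last exact: measurable0.
  exact: measurableX.
exists (pickle (i, j)); rewrite pickleK; split => //.
by move=> [u v] [/= /iA uA /jA vA]; apply: sA.
Qed.

(** An open set is the union of the members of the base that it contains, a countable union. *)
Lemma measurable_base_open (d : measure_display) (T : measurableType d)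
    (N : T -> set_system T) (A : set T) :
  measurable_base N -> (forall x, A x -> N x A) -> measurable A.
Proof.
move=> [B [mB BP]] oA.
rewrite (_ : A = \bigcup_(n in [set n | B n `<=` A]) B n).
  by apply: bigcup_measurable => n _; exact: mB.
apply/seteqP; split=> [x /[dup] Ax /oA/BP[n [nx nA]]|x [n nA]]; last exact: nA.
by exists n.
Qed.

Lemma measurable_base_R (R : realType) :
  @measurable_base _ (measurableTypeR R) (fun x : R => nbhs x).
Proof.
exists (fun n => if @unpickle (rat * rat)%type n is Some (a, b) then `]ratr a, ratr
    b[%classic else set0).
split=> [n|x A /nbhs_ballP[e /= e0 eA]].
  case: unpickle => [[i j]|]; last exact: measurable0.
  exact: measurable_itv.
have /rat_in_itvoo[a] : x - e < x by rewrite ltrBlDr ltrDl.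
have /rat_in_itvoo[b] : x < x + e by rewrite ltrDl.
rewrite !in_itv /= => /andP[xb be] /andP[ea ax].
exists (pickle (a, b)); rewrite pickleK /= in_itv /= ax xb; split=> // y /=.
rewrite in_itv /= => /andP[ay yb]; apply: eA; rewrite /ball /= distrC ltr_distl.
by rewrite (lt_trans ea)//= (lt_trans yb).
Qed.

Lemma measurable_open4 (R : realType) (A : set ((R * R) * (R * R))) :
  (forall q, A q -> nbhs q A) -> measurable A.
Proof.
apply: measurable_base_open.
have b2 := measurable_base_prod (@measurable_base_R R) (@measurable_base_R R).
exact: (measurable_base_prod b2 b2).
Qed.

Lemma measurable_open2 (R : realType) (A : set (R * R)) :
  (forall q, A q -> nbhs q A) -> measurable A.
Proof.
apply: measurable_base_open.
exact: (measurable_base_prod (@measurable_base_R R) (@measurable_base_R R)).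
Qed.

(** * Averaging over rotations and the comparison of norms *)

(** Integrate the hypothesis over [q] and exchange the integrals. Each [rot t] preserves the
    integral of [F], so the right side becomes [a] times that integral, and [a] cancels. *)
Lemma integral_le_average (d : measure_display) (Q : measurableType d)
    (R : realType) (m : {sigma_finite_measure set Q -> \bar R})
    (rot : measurableTypeR R -> Q -> Q) (F G : Q -> \bar R) (a : R) :
  0 < a ->
  measurable_fun [set: Q * measurableTypeR R] (fun x => rot x.2 x.1) ->
  (forall t, integral_preserving m (rot t)) ->
  measurable_fun [set: Q] F -> (forall q, (0 <= F q)%E) ->
  measurable_fun [set: Q] G -> (forall q, (0 <= G q)%E) ->
  (forall q, (a%:E * G q <=
     \int[@lebesgue_measure R]_(t in `[0%R, a]) F (rot t q))%E) ->
  (\int[m]_q G q <= \int[m]_q F q)%E.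
Proof.
move=> a0 mrot prot mF F0 mG G0 H.
have aE0 : (0 < a%:E)%E by rewrite lte_fin.
have mI : measurable (`[0%R, a]%classic : set (measurableTypeR R)) by exact:
    measurable_itv.
pose I : set (measurableTypeR R) := `[0%R, a]%classic.
pose f (x : Q * measurableTypeR R) := (F (rot x.2 x.1) * (\1_I x.2)%:E)%E.
have mf : measurable_fun [set: Q * measurableTypeR R] f.
  apply: emeasurable_funM; first exact: measurableT_comp.
  apply/measurable_EFinP; apply: measurableT_comp => //.
have f0 x : (0 <= f x)%E by rewrite mule_ge0// lee_fin.
have fE q : (\int[@lebesgue_measure R]_t f (q, t) =
    \int[@lebesgue_measure R]_(t in I) F (rot t q))%E.
  rewrite [RHS]integral_mkcond; apply: eq_integral => t _.
  by rewrite /f patchE indicE /=; case: ifPn => _; rewrite ?mule1 ?mule0.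
have := @fubini_tonelli _ _ Q (measurableTypeR R) R m lebesgue_measure f mf f0.
under eq_integral do rewrite fE.
have -> : (\int[lebesgue_measure]_y \int[m]_x f (x, y) =
    \int[m]_q F q * a%:E)%E.
  transitivity (\int[@lebesgue_measure R]_(t in I) (\int[m]_q F q))%E.
    rewrite [RHS]integral_mkcond; apply: eq_integral => t _.
    under eq_integral do rewrite /f /= indicE.
    rewrite patchE; case: (t \in I) => /=.
      under eq_integral do rewrite mule1.
      by have [_] := prot t; apply.
    by under eq_integral do rewrite mule0; rewrite integral0.
  by rewrite integral_cst//= lebesgue_measure_itv/= lte_fin a0 sube0.
move=> E; rewrite -(@lee_pmul2r _ a%:E)// -E muleC -ge0_integralZl//; last exact: ltW.
apply: ge0_le_integral => //.
- by move=> q _; rewrite mule_ge0// ltW.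
- exact: measurable_funeM.
- have := @measurable_fun_fubini_tonelli_F _ _ Q (measurableTypeR R) R lebesgue_measure
    f mf f0.
  by apply: eq_measurable_fun => q _; rewrite /fubini_F fE.
Qed.

Lemma measurable_fun_open (d : measure_display) (T : measurableType d)
    (R : realType) (N : T -> set_system T) (D : set T) (f : T -> R) :
  (forall A : set T, (forall q, A q -> N q A) -> measurable A) ->
  (forall q, ProperFilter (N q)) ->
  (forall q, D q -> N q D) -> (forall q, D q -> f x @[x --> N q] --> f q) ->
  measurable_fun D f.
Proof.
move=> oM pN oD cf mD; apply: (measurability _ (RGenOInfty.measurableE R)) => //.
move=> /= _ [_ [a ->] <-]; apply: oM => q [Dq /=]; rewrite in_itv/= andbT => aq.
apply: filterI; first exact: oD.
have /cvgr_gt/(_ a aq) := cf q Dq.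
by apply: filterS => x /= ax; rewrite in_itv/= andbT.
Qed.

Definition rotate (R : realType) (t : measurableTypeR R)
    (p : measurableTypeR R * measurableTypeR R) :
    measurableTypeR R * measurableTypeR R :=
  (cos t * p.1 - sin t * p.2, sin t * p.1 + cos t * p.2).

Lemma to_C_rotate (R : realType) (t : R) (p : R * R) :
  to_C (rotate t p) = cexp (0 +i* t)%C * to_C p.
Proof.
by case: p => x y; apply/eqP; rewrite eq_complex /= expR0 !mul1r [X in _ && (X ==
    _)]addrC !eqxx.
Qed.

Lemma plane_preserving_rotate (R : realType) (t : measurableTypeR R) :
  plane_preserving (rotate t).
Proof. by apply: plane_preserving_rotation; exact: cos2Dsin2. Qed.

Lemma measurable_rotate (R : realType) :
  measurable_fun [set: (measurableTypeR R * measurableTypeR R) * measurableTypeR R]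
    (fun x => rotate x.2 x.1).
Proof.
have mc : measurable_fun [set: (measurableTypeR R * measurableTypeR R) *
    measurableTypeR R]
    (fun x => cos x.2 : measurableTypeR R).
  apply: (measurableT_comp (f := (@cos R : measurableTypeR R -> measurableTypeR R))) =>
      //.
  by apply: continuous_measurable_fun; exact: continuous_cos.
have ms : measurable_fun [set: (measurableTypeR R * measurableTypeR R) *
    measurableTypeR R]
    (fun x => sin x.2 : measurableTypeR R).
  apply: (measurableT_comp (f := (@sin R : measurableTypeR R -> measurableTypeR R))) =>
      //.
  by apply: continuous_measurable_fun; exact: continuous_sin.
have m1 : measurable_fun [set: (measurableTypeR R * measurableTypeR R) *
    measurableTypeR R]
    (fun x => x.1.1) by exact: measurableT_comp.
have m2 : measurable_fun [set: (measurableTypeR R * measurableTypeR R) *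
    measurableTypeR R]
    (fun x => x.1.2) by exact: measurableT_comp.
apply/measurable_fun_pairP; split; rewrite /comp /=.
  by apply: measurable_funB; apply: measurable_funM.
by apply: measurable_funD; apply: measurable_funM.
Qed.

Lemma measurable_rotate2 (R : realType) :
  measurable_fun [set: ((measurableTypeR R * measurableTypeR R) *
      (measurableTypeR R * measurableTypeR R)) * measurableTypeR R]
    (fun x => (rotate x.2 x.1.1, rotate x.2 x.1.2)).
Proof.
apply/measurable_fun_pairP; split; rewrite /comp /=.
  apply: (measurableT_comp (@measurable_rotate R) (g := fun x => (x.1.1, x.2))).
  by apply/measurable_fun_pairP; split; rewrite /comp //=; exact: measurableT_comp.
apply: (measurableT_comp (@measurable_rotate R) (g := fun x => (x.1.2, x.2))).
by apply/measurable_fun_pairP; split; rewrite /comp //=; exact: measurableT_comp.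
Qed.

Definition bidisk4 (R : realType) :
    set ((measurableTypeR R * measurableTypeR R) * (measurableTypeR R * measurableTypeR
        R)) :=
  [set q | bidisk (to_C2 q)].

Definition density (R : realType) (g : C2 R -> Cplx R) (e : R)
    (q : (measurableTypeR R * measurableTypeR R) * (measurableTypeR R * measurableTypeR
        R)) : R :=
  modulus (g (to_C2 q)) ^+ 2 / wden e (to_C2 q).

Lemma nbhs_bidisk4 (R : realType) (q : (R * R) * (R * R)) :
  bidisk4 q -> nbhs q (@bidisk4 R).
Proof.
move=> [q1 q2].
have c1 : modulus (to_C x.1) @[x --> q] --> modulus (to_C q.1).
  exact: (cvg_comp _ _ (cvg_comp fst (@to_C R) cvg_fst (@continuous_to_C R q.1))
    (@continuous_modulus R (to_C q.1))).
have c2 : modulus (to_C x.2) @[x --> q] --> modulus (to_C q.2).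
  exact: (cvg_comp _ _ (cvg_comp snd (@to_C R) cvg_snd (@continuous_to_C R q.2))
    (@continuous_modulus R (to_C q.2))).
move/cvgr_lt : c1 => /(_ 1 q1) n1; move/cvgr_lt : c2 => /(_ 1 q2) n2.
exact: filterI n1 n2.
Qed.

Lemma continuous_density (R : realType) (g : C2 R -> Cplx R) (e : R)
    (q : (R * R) * (R * R)) :
  0 < e -> holomorphic2 (@bidisk R) g -> bidisk4 q ->
  density g e x @[x --> q] --> density g e q.
Proof.
move=> e0 hg qb.
have cg := cvg_comp _ _ (@continuous_to_C2 R q) (differentiable_continuous (hg _ qb)).
have c1 := cvg_comp _ _ cg (@continuous_modulus R (g (to_C2 q))).
have c2 := cvg_comp _ _ (@continuous_to_C2 R q) (@continuous_wden R e (to_C2 q)).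
apply: cvgM; first by apply: cvgM; exact: c1.
by apply: cvgV; [rewrite lt0r_neq0// wden_gt0|exact: c2].
Qed.

Lemma measurable_density (R : realType) (g : C2 R -> Cplx R) (e : R) :
  0 < e -> holomorphic2 (@bidisk R) g ->
  measurable (@bidisk4 R) /\ measurable_fun (@bidisk4 R) (density g e).
Proof.
move=> e0 hg; split.
  by apply: measurable_open4 => q; exact: nbhs_bidisk4.
apply: (@measurable_fun_open _ _ R (fun q : (R * R) * (R * R) => nbhs q)).
- exact: measurable_open4.
- exact: nbhs_bidisk4.
- by move=> q; exact: continuous_density.
Qed.

Lemma density_ge0 (R : realType) (g : C2 R -> Cplx R) (e : R)
    (q : (measurableTypeR R * measurableTypeR R) * (measurableTypeR R * measurableTypeR
        R)) :
  0 < e -> 0 <= density g e q.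
Proof. by move=> e0; rewrite divr_ge0 ?sqr_ge0// ltW// wden_gt0. Qed.

Lemma wsq_weight (R : realType) (w : Cplx R) (e : R) (z : C2 R) : 0 < e ->
  wsq w (weight e z) = (modulus w ^+ 2 / wden e z)%:E.
Proof.
move=> e0; rewrite /wsq /weight -EFinN /= -EFinM expRN lnK// posrE.
exact: wden_gt0.
Qed.

Definition lebesgue4 (R : realType) :
    {sigma_finite_measure set ((measurableTypeR R * measurableTypeR R) *
       (measurableTypeR R * measurableTypeR R))%type -> \bar R} :=
  let l : {sigma_finite_measure set (measurableTypeR R) -> \bar R} := @lebesgue_measure
      R in
  product_sf (product_sf l l) (product_sf l l).

Lemma sqnorm_density (R : realType) (g : C2 R -> Cplx R) (e : R) : 0 < e ->
  sqnorm (weight e) g =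
  (\int[lebesgue4 R]_q ((EFin \o density g e) \_ (@bidisk4 R)) q)%E.
Proof.
move=> e0.
transitivity (\int[lebesgue4 R]_(q in @bidisk4 R) wsq (g (to_C2 q)) (weight e (to_C2
    q)))%E.
  by [].
rewrite integral_mkcond; apply: eq_integral => q _.
by rewrite /patch wsq_weight.
Qed.

Lemma to_C2_rotate (R : realType) (t : R) (q : (R * R) * (R * R)) :
  to_C2 (rotate t q.1, rotate t q.2) =
  (cexp (0 +i* t)%C * (to_C2 q).1, cexp (0 +i* t)%C * (to_C2 q).2).
Proof. by rewrite /to_C2 /= !to_C_rotate. Qed.

Lemma modulus_cexp_imag (R : realType) (t : R) : modulus (cexp (0 +i* t)%C) = 1.
Proof. by rewrite modulus_cexp expR0. Qed.

Lemma bidisk4_rotate (R : realType) (t : R) (q : (R * R) * (R * R)) :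
  bidisk4 (rotate t q.1, rotate t q.2) = bidisk4 q.
Proof.
by rewrite /bidisk4 /mkset to_C2_rotate /bidisk /mkset !modulusM modulus_cexp_imag !mul1r.
Qed.

Lemma density_rotate (R : realType) (g : C2 R -> Cplx R) (e t : R)
    (q : (R * R) * (R * R)) :
  density g e (rotate t q.1, rotate t q.2) =
  (wden e (to_C2 q))^-1 * modulus (g (cexp (0 +i* t)%C * (to_C2 q).1,
                     cexp (0 +i* t)%C * (to_C2 q).2)) ^+ 2.
Proof.
rewrite /density to_C2_rotate mulrC; congr (_^-1 * _).
rewrite /wden; congr (_ ^+ 2 + _).
transitivity (modulus (cexp (0 +i* t)%C * ((to_C2 q).1 + (to_C2 q).2))).
  by rewrite mulrDr.
by rewrite modulusM modulus_cexp_imag mul1r.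
Qed.

Lemma differentiable_coord_diff (R : realType) (z : C2 R) :
  differentiable (fun z : C2 R => z.1 - z.2 : Cplx R) z.
Proof.
apply: differentiableB.
  by apply: (@linear_differentiable _ _ _ fst) => x; exact: cvg_fst.
by apply: (@linear_differentiable _ _ _ snd) => x; exact: cvg_snd.
Qed.

Definition coord_diff (R : realType) (z : C2 R) : Cplx R := z.1 - z.2.

(** The weight is constant on the orbit of [q] under rotations, so the circle inequality may be
    divided by [wden]. The result is the hypothesis of [integral_le_average] with [a = 2 pi]; off
    the bidisk its left side vanishes. *)
Lemma sqnorm_coord_diff_le (R : realType) (e : R) (g : C2 R -> Cplx R) :
  0 < e -> holomorphic2 (@bidisk R) g ->
  (forall w, unit_disk w -> on_V1 g w = - w) ->
  (forall w, unit_disk w -> on_V2 g w = w) ->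
  (sqnorm (weight e) (@coord_diff R) <= sqnorm (weight e) g)%E.
Proof.
move=> e0 hg g1 g2; rewrite !sqnorm_density//.
set h := @coord_diff R.
have hh : holomorphic2 (@bidisk R) h by move=> z _; exact: differentiable_coord_diff.
have nonneg (k : C2 R -> Cplx R) q : (0 <= ((EFin \o density k e) \_ (@bidisk4 R)) q)%E.
  by rewrite patchE; case: ifP => // _; rewrite lee_fin density_ge0.
have meas (k : C2 R -> Cplx R) : holomorphic2 (@bidisk R) k ->
    measurable_fun setT ((EFin \o density k e) \_ (@bidisk4 R)).
  move=> hk; have [mB mk] := measurable_density e0 hk.
  by apply/(measurable_restrictT _ mB)/measurable_EFinP.
have prot t : integral_preserving (lebesgue4 R) (fun q => (rotate t q.1, rotate t q.2)).
  exact: (integral_preserving_prod2 (plane_preserving_rotate t)).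
have tpi : 0 < 2 * pi :> R by rewrite mulr_gt0// pi_gt0.
apply: (integral_le_average tpi (@measurable_rotate2 R) prot (meas g hg) (nonneg g)
  (meas h hh) (nonneg h)) => q.
set F := (EFin \o density g e) \_ (@bidisk4 R).
have [qb|qb] := pselect (bidisk4 q); last first.
  rewrite patchE memNset// mule0; apply: integral_ge0 => t _; exact: nonneg.
rewrite patchE mem_set// /=.
have w0 := wden_gt0 (to_C2 q) e0.
have E t : F (rotate t q.1, rotate t q.2) = ((wden e (to_C2 q))^-1%:E *
    (modulus (g (cexp (0 +i* t)%C * (to_C2 q).1, cexp (0 +i* t)%C * (to_C2 q).2)) ^+
        2)%:E)%E.
  by rewrite /F patchE mem_set ?bidisk4_rotate//= density_rotate.
have mFt : measurable_fun [set: measurableTypeR R] (fun t => F (rotate t q.1, rotate t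
    q.2)).
  apply: (measurableT_comp (meas g hg)).
  apply: (measurableT_comp (@measurable_rotate2 R) (g := fun t => (q, t))).
  exact: pair1_measurable.
have := circle_inequality hg g1 g2 qb.
have -> : (\int[@lebesgue_measure R]_(y in `[0%R, (2 * pi)%R])
     (modulus (g (cexp (0 +i* y)%C * (to_C2 q).1, cexp (0 +i* y)%C * (to_C2 q).2)) ^+
         2)%:E =
   (wden e (to_C2 q))%:E * \int[@lebesgue_measure R]_(y in `[0%R, (2 * pi)%R])
     F (rotate y q.1, rotate y q.2))%E.
  rewrite -ge0_integralZl//; last 3 first.
  - exact: measurable_funS mFt.
  - by move=> t _; exact: nonneg.
  - by rewrite lee_fin ltW.
  apply: eq_integral => t _; rewrite E -!EFinM mulrA divff ?mul1r//.
  exact: lt0r_neq0.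
rewrite muleC -lee_pdivrMr// => H; apply: le_trans H.
rewrite -EFinM -EFinM lee_fin /density mulrC mulrAC.
exact: lexx.
Qed.

(** * Upper bounds on the branches *)

(** Serves with [X] the real line for the branches and with [X] the plane for the finiteness of the
    norm on the bidisk. *)
Lemma ge0_integral_le_prod (d : measure_display) (X : measurableType d)
    (R : realType) (m : {sigma_finite_measure set X -> \bar R})
    (D : set (X * X)) (F : X * X -> \bar R) (k : X -> R) (K : R) :
  measurable D -> measurable_fun D F -> (forall p, D p -> (0 <= F p)%E) ->
  (forall p, D p -> (F p <= (k p.1 * k p.2)%:E)%E) ->
  measurable_fun [set: X] k -> (forall x, 0 <= k x) ->
  (\int[m]_x (k x)%:E <= K%:E)%E ->
  (\int[m \x m]_(p in D) F p <= (K * K)%:E)%E.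
Proof.
move=> mD mF F0 Fk mk k0 kK.
pose f (p : X * X) := (k p.1 * k p.2)%:E.
have mf : measurable_fun [set: X * X] f.
  by apply/measurable_EFinP; apply: measurable_funM; exact: measurableT_comp.
have f0 p : (0 <= f p)%E by rewrite lee_fin mulr_ge0.
have mkE : measurable_fun [set: X] (EFin \o k) by exact/measurable_EFinP.
have kE0 x : (0 <= (EFin \o k) x)%E by rewrite lee_fin.
have i0 : (0 <= \int[m]_x (k x)%:E)%E by apply: integral_ge0 => x _; exact: kE0.
apply: (@le_trans _ _ (\int[product_sf m m]_(p in D) f p)%E).
  by apply: (@ge0_le_integral _ _ _ (product_sf m m)) => //; exact: measurable_funS mf.
apply: (@le_trans _ _ (\int[product_sf m m]_p f p)%E).
  by apply: (@ge0_subset_integral _ _ _ (product_sf m m)).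
rewrite (_ : integral _ _ _ = \int[m]_x \int[m]_y f (x, y))%E; last exact:
    fubini_tonelli1.
have -> : (\int[m]_x \int[m]_y f (x, y) =
    \int[m]_x (\int[m]_y (k y)%:E * (k x)%:E))%E.
  apply: eq_integral => x _; rewrite muleC.
  by rewrite -(ge0_integralZl m measurableT mkE (fun y _ => kE0 y) (kE0 x)).
rewrite (ge0_integralZl m measurableT mkE (fun y _ => kE0 y) i0).
by rewrite EFinM; exact: lee_pmul.
Qed.

Lemma continuous_to_C_modulus (R : realType) (p : R * R) :
  modulus (to_C x) @[x --> p] --> modulus (to_C p).
Proof. exact: (cvg_comp _ _ (@continuous_to_C R p) (@continuous_modulus R (to_C p))). Qed.

(** The disk lies in the square [[-1, 1]^2], so the product majorant cut off to that square
    applies. *)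
Lemma integral_C_le (R : realType) (F : Cplx R -> R) (a : R -> R) (K : R) :
  (forall p : R * R, F (to_C x) @[x --> p] --> F (to_C p)) -> (forall w, 0 <= F w) ->
  (forall x y, F (x +i* y)%C <= a x * a y) -> continuous a -> (forall x, 0 <= a x) ->
  (\int[@lebesgue_measure R]_(x in `[(-1)%R, 1%R]) (a x)%:E <= K%:E)%E ->
  (integral_C (@unit_disk R) (fun w => (F w)%:E) <= (K * K)%:E)%E.
Proof.
move=> cF F0 Fa ca a0 aK.
pose I : set (measurableTypeR R) := `[(-1)%R, 1%R]%classic.
pose k (x : measurableTypeR R) : R := a x * \1_I x.
have mI : measurable I by exact: measurable_itv.
have oD (p : R * R) : unit_disk (to_C p) -> nbhs p [set p | unit_disk (to_C p)].
  by move=> pD; have /cvgr_lt/(_ 1 pD) := @continuous_to_C_modulus R p.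
have ma : measurable_fun [set: measurableTypeR R] a by exact: continuous_measurable_fun.
have mk : measurable_fun [set: measurableTypeR R] k by apply: measurable_funM.
rewrite /integral_C.
apply: (@ge0_integral_le_prod _ (measurableTypeR R) R lebesgue_measure _ _ k) => //.
- by apply: measurable_open2.
- apply/measurable_EFinP.
  apply: (@measurable_fun_open _ _ R (fun q : R * R => nbhs q)) => //.
    exact: measurable_open2.
  by move=> q _; exact: cF.
- by move=> p _; rewrite lee_fin.
- move=> [x y] pD; rewrite lee_fin /k /=.
  have inI (t : R) : `|t| <= modulus (to_C (x, y)) -> \1_I t = 1 :> R.
    move=> tm; rewrite indicE mem_set// /I /= in_itv/= -ler_norml.
    exact: (le_trans tm (ltW pD)).
  by rewrite !inI ?mulr1 ?Fa ?Re_le_modulus ?Im_le_modulus//; [exact: (@Im_le_modulus R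
      (x +i* y)%C)|exact: (@Re_le_modulus R (x +i* y)%C)].
- by move=> x; rewrite mulr_ge0.
- rewrite (_ : integral _ _ _ = \int[@lebesgue_measure R]_(x in I) (a x)%:E)%E//.
  rewrite [RHS]integral_mkcond; apply: eq_integral => x _.
  by rewrite /k patchE indicE; case: (x \in I); rewrite ?mulr1 ?mulr0.
Qed.

(** The antiderivative [atan (x / e)] varies by at most [pi], whatever [e] is. This is the source of
    the uniformity in [e]. *)
Lemma integral_arctan_le (R : realType) (e : R) : 0 < e ->
  (\int[@lebesgue_measure R]_(x in `[(-1)%R, 1%R]) (e / (x ^+ 2 + e ^+ 2))%:E <= pi%:E)%E.
Proof.
move=> e0; pose F x := atan (x * e^-1).
have N0 (x : R) : x ^+ 2 + e ^+ 2 != 0 by rewrite lt0r_neq0// ltr_wpDl ?sqr_ge0//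
    exprn_gt0.
have dF (x : R) : is_derive x 1 F (e / (x ^+ 2 + e ^+ 2)).
  have d1 : is_derive x 1 (fun x : R => x * e^-1) e^-1.
    have := is_deriveM (is_derive_id x 1) (is_derive_cst e^-1 x 1).
    by rewrite scaler0 add0r [_ *: 1]mulr1.
  have [h1 h2] := @is_derive1_comp R (@atan R) (fun x : R => x * e^-1) x _ _
    (is_derive1_atan (x * e^-1)) d1.
  split; first exact: h1.
  transitivity ((1 + (x * e^-1) ^+ 2)^-1 * e^-1); first exact: h2.
  field.
  by rewrite N0 lt0r_neq0.
rewrite (@continuous_FTC2 R _ F (-1) 1); first last.
- by move=> x _; rewrite derive1E; have [_ ->] := dF x.
- have cF : continuous F.
    by move=> x; apply: differentiable_continuous; apply/derivable1_diffP; have [] :=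
        dF x.
  split; first by move=> x _; have [] := dF x.
    by apply: cvg_at_right_filter; exact: cF.
  by apply: cvg_at_left_filter; exact: cF.
- apply: continuous_subspaceT => x; apply: cvgM; first exact: cvg_cst.
  apply: cvgV => //; apply: cvgD; last exact: cvg_cst.
  by apply: cvgM; exact: cvg_id.
- by rewrite (@lt_trans _ _ 0)// ltrN10.
rewrite -EFinB lee_fin /F.
have := atan_ltpi2 (1 * e^-1); have := atan_gtNpi2 (-1 * e^-1).
by lra.
Qed.

Lemma derive1_ln_sqr (R : realType) (c x : R) : 0 < c ->
  derive1 (fun x : R => ln (x ^+ 2 + c)) x = 2 * x / (x ^+ 2 + c).
Proof.
move=> c0; have N0 : 0 < x ^+ 2 + c by rewrite ltr_wpDl ?sqr_ge0.
have d1 : is_derive x 1 (fun x : R => x ^+ 2 + c) (2 * x).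
  have [h1 h2] := is_deriveD (is_deriveM (is_derive_id x 1) (is_derive_id x 1))
      (is_derive_cst c x 1).
  split; first exact: h1.
  by rewrite [LHS]h2 addr0 [_ *: 1]mulr1 mulr_natl mulr2n.
have [_ h2] := @is_derive1_comp R (@ln R) (fun x : R => x ^+ 2 + c) x _ _
  (is_derive1_ln N0) d1.
by rewrite derive1E [LHS]h2 mulrC.
Qed.

Lemma wirtinger_ln (R : realType) (psi : Cplx R -> \bar R) (e : R) (z : Cplx R) :
  0 < e -> (forall w, psi w = (ln (modulus w ^+ 2 + e ^+ 2))%:E) ->
  wirtinger psi z = ((z^*)%C * (((modulus z ^+ 2 + e ^+ 2)^-1)%:C)%C).
Proof.
move=> e0 psiE; rewrite sqr_modulus; case: z => x y; rewrite /wirtinger /=.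
have -> : (fun x0 : R => fine (psi (x0 +i* y)%C)) =
    (fun x0 : R => ln (x0 ^+ 2 + (y ^+ 2 + e ^+ 2))).
  by apply/funext => t; rewrite psiE sqr_modulus /= addrA.
have -> : (fun y0 : R => fine (psi (x +i* y0)%C)) =
    (fun y0 : R => ln (y0 ^+ 2 + (x ^+ 2 + e ^+ 2))).
  by apply/funext => t; rewrite psiE sqr_modulus /= addrA [x ^+ 2 + t ^+ 2]addrC.
have p0 (t : R) : 0 < t ^+ 2 + e ^+ 2 by rewrite ltr_wpDl ?sqr_ge0// exprn_gt0.
rewrite !derive1_ln_sqr// [y ^+ 2 + (_ + _)]addrCA addrA.
have N0 : x ^+ 2 + y ^+ 2 + e ^+ 2 != 0.
  by rewrite -addrA lt0r_neq0// ltr_wpDl ?sqr_ge0.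
by apply/eqP; rewrite eq_complex /=; apply/andP; split; apply/eqP; field.
Qed.

(** The two terms combine to [c (1 - |z|^2 / (|z|^2 + e^2))]. *)
Lemma modulus_twisted_d (R : realType) (psi : Cplx R -> \bar R) (f : Cplx R -> Cplx R)
    (e : R) (c z : Cplx R) :
  0 < e -> (forall w, psi w = (ln (modulus w ^+ 2 + e ^+ 2))%:E) ->
  (forall w, f w = c * w) -> modulus c = 1 ->
  modulus (twisted_d psi f z) = e ^+ 2 / (modulus z ^+ 2 + e ^+ 2).
Proof.
move=> e0 psiE fE c1.
have N0 : 0 < modulus z ^+ 2 + e ^+ 2 by rewrite ltr_wpDl ?sqr_ge0// exprn_gt0.
have -> : twisted_d psi f z = c * ((e ^+ 2 / (modulus z ^+ 2 + e ^+ 2))%:C)%C.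
  rewrite /twisted_d (wirtinger_ln z e0 psiE).
  have -> : 'D_1 f z = c.
    have -> : f = (fun w : Cplx R => c * w) by apply/funext.
    have [_ h] := is_deriveZ c (is_derive_id z 1).
    by rewrite [LHS]h [_ *: 1]mulr1.
  rewrite fE mulrA -[c * z * _]mulrA [z * _]mulrC sqr_modulus_conj -mulrA -rmorphM/=.
  rewrite -{1}[c]mulr1 -mulrBr; congr (c * _).
  have -> : 1 = (1%:C)%C :> Cplx R by [].
  rewrite -rmorphB; congr (_%:C)%C.
  by field; rewrite lt0r_neq0.
rewrite modulusM c1 mul1r /modulus /= expr0n addr0 sqrtr_sqr ger0_norm//.
by rewrite divr_ge0 ?sqr_ge0// ltW.
Qed.

Lemma wsq_ln (R : realType) (w : Cplx R) (s : R) : 0 < s ->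
  wsq w (ln s)%:E = (modulus w ^+ 2 / s)%:E.
Proof. by move=> s0; rewrite /wsq -EFinN /= -EFinM expRN lnK. Qed.

Lemma sqnorm_branch_le (R : realType) (psi : Cplx R -> \bar R)
    (f : Cplx R -> Cplx R) (e : R) :
  0 < e -> (forall w, psi w = (ln (modulus w ^+ 2 + e ^+ 2))%:E) ->
  (forall w, modulus (f w) = modulus w) ->
  (integral_C (@unit_disk R) (fun w => wsq (f w) (psi w)) <= (2 * 2)%:E)%E.
Proof.
move=> e0 psiE fE.
have N0 (w : Cplx R) : 0 < modulus w ^+ 2 + e ^+ 2.
  by rewrite ltr_wpDl ?sqr_ge0// exprn_gt0.
pose F (w : Cplx R) := modulus w ^+ 2 / (modulus w ^+ 2 + e ^+ 2).
have -> : (fun w => wsq (f w) (psi w)) = (fun w => (F w)%:E).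
  by apply/funext => w; rewrite psiE wsq_ln// fE.
apply: (@integral_C_le R F (fun=> 1)) => //.
- move=> p; have c := @continuous_to_C_modulus R p.
  have c2 : modulus (to_C x) ^+ 2 @[x --> p] --> modulus (to_C p) ^+ 2.
    by apply: cvgM; exact: c.
  apply: cvgM; first exact: c2.
  by apply: cvgV; [rewrite lt0r_neq0|apply: cvgD; [exact: c2|exact: cvg_cst]].
- by move=> w; rewrite divr_ge0 ?sqr_ge0// ltW.
- by move=> x y; rewrite mulr1 ler_pdivrMr// mul1r lerDl sqr_ge0.
- by move=> x; exact: cvg_cst.
- rewrite integral_cst//= lebesgue_measure_itv/= lte_fin ifT; last by lra.
  by rewrite mul1e -EFinB lee_fin; lra.
Qed.

Lemma sqnorm_twisted_branch_le (R : realType) (psi : Cplx R -> \bar R)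
    (f : Cplx R -> Cplx R) (e : R) :
  0 < e -> (forall w, psi w = (ln (modulus w ^+ 2 + e ^+ 2))%:E) ->
  (forall w, modulus (f w) = e ^+ 2 / (modulus w ^+ 2 + e ^+ 2)) ->
  (integral_C (@unit_disk R) (fun w => wsq (f w) (psi w)) <= (pi * pi)%:E)%E.
Proof.
move=> e0 psiE fE.
have N0 (w : Cplx R) : 0 < modulus w ^+ 2 + e ^+ 2.
  by rewrite ltr_wpDl ?sqr_ge0// exprn_gt0.
have M0 (x : R) : 0 < x ^+ 2 + e ^+ 2 by rewrite ltr_wpDl ?sqr_ge0// exprn_gt0.
pose F (w : Cplx R) := (e ^+ 2 / (modulus w ^+ 2 + e ^+ 2)) ^+ 2 / (modulus w ^+ 2 + e
    ^+ 2).
have -> : (fun w => wsq (f w) (psi w)) = (fun w => (F w)%:E).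
  by apply/funext => w; rewrite psiE wsq_ln// fE.
apply: (@integral_C_le R F (fun x => e / (x ^+ 2 + e ^+ 2))) => //.
- move=> p; have c := @continuous_to_C_modulus R p.
  have c1 : modulus (to_C x) ^+ 2 @[x --> p] --> modulus (to_C p) ^+ 2.
    by apply: cvgM; exact: c.
  have c2 : (modulus (to_C x) ^+ 2 + e ^+ 2)^-1 @[x --> p] --> (modulus (to_C p) ^+ 2 +
      e ^+ 2)^-1.
    by apply: cvgV; [rewrite lt0r_neq0|apply: cvgD; [exact: c1|exact: cvg_cst]].
  have c3 : e ^+ 2 / (modulus (to_C x) ^+ 2 + e ^+ 2) @[x --> p] --> e ^+ 2 / (modulus
      (to_C p) ^+ 2 + e ^+ 2).
    by apply: cvgM; [exact: cvg_cst|exact: c2].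
  by apply: cvgM; [apply: cvgM; exact: c3|exact: c2].
- by move=> w; rewrite divr_ge0 ?sqr_ge0// ltW.
- move=> x y; rewrite /F; set S := modulus _ ^+ 2 + e ^+ 2.
  have SE : S = x ^+ 2 + y ^+ 2 + e ^+ 2 by rewrite /S sqr_modulus.
  have S0 : 0 < S by exact: N0.
  have e2 : 0 < e ^+ 2 by rewrite exprn_gt0.
  have x2 := sqr_ge0 x; have y2 := sqr_ge0 y.
  rewrite (_ : _ / S = e ^+ 2 * (e ^+ 2 / S ^+ 3)); last by field; rewrite lt0r_neq0.
  rewrite mulf_div -expr2 ler_pM2l// ler_pdivrMr ?exprn_gt0//.
  rewrite -ler_pdivrMl ?invr_gt0 ?mulr_gt0// invrK.
  (* The cube of [S] is bounded below by giving each factor its own minorant: [e^2], [x^2 + e^2] and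
     [y^2 + e^2]. *)
  have l1 : e ^+ 2 <= S by rewrite SE; lra.
  have l2 : x ^+ 2 + e ^+ 2 <= S by rewrite SE; lra.
  have l3 : y ^+ 2 + e ^+ 2 <= S by rewrite SE; lra.
  have x0 := ltW (M0 x); have y0 := ltW (M0 y).
  rewrite (_ : S ^+ 3 = S * S * S); last by ring.
  apply: ler_pM => //; [exact: mulr_ge0|exact: ltW|exact: ler_pM].
- move=> x; apply: cvgM; first exact: cvg_cst.
  apply: cvgV; first by rewrite lt0r_neq0.
  by apply: cvgD; [apply: cvgM; exact: cvg_id|exact: cvg_cst].
- by move=> x; rewrite divr_ge0 ?ltW.
- exact: integral_arctan_le.
Qed.

Lemma sqnorm_V_weight_le (R : realType) (e : R) : 0 < e ->
  (sqnorm_V (weight e) (fun w : Cplx R => - w)%R id +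
   sqnorm_V (weight e) (twisted_d (on_V1 (weight e)) (fun w : Cplx R => - w)%R)
                       (twisted_d (on_V2 (weight e)) id) <=
   (8 + 2 * (pi * pi))%:E)%E.
Proof.
move=> e0.
have E1 w : on_V1 (weight e) w = (ln (modulus w ^+ 2 + e ^+ 2))%:E.
  by rewrite /on_V1 /weight /wden add0r.
have E2 w : on_V2 (weight e) w = (ln (modulus w ^+ 2 + e ^+ 2))%:E.
  by rewrite /on_V2 /weight /wden addr0.
have T1 w := @modulus_twisted_d R (on_V1 (weight e)) (fun w => - w) e (- 1) w e0 E1
  (fun w => esym (mulN1r w)).
have T2 w := @modulus_twisted_d R (on_V2 (weight e)) id e 1 w e0 E2
  (fun w => esym (mul1r w)).
have m1 : modulus (1 : Cplx R) = 1 by exact: ComplexField.Normc.normc1.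
have B1 := sqnorm_branch_le e0 E1 (fun w => modulusN w).
have B2 := @sqnorm_branch_le R _ id e e0 E2 (fun w => erefl).
have B3 := sqnorm_twisted_branch_le e0 E1 (fun w => T1 w (etrans (modulusN _) m1)).
have B4 := sqnorm_twisted_branch_le e0 E2 (fun w => T2 w m1).
have -> : 8 + 2 * (pi * pi) = (2 * 2 + 2 * 2) + (pi * pi + pi * pi) :> R by ring.
exact: (leeD (leeD B1 B2) (leeD B3 B4)).
Qed.

(** * Logarithmic growth of the norm of [z1 - z2] *)

(* Bounds [1 / (s^2 + 4^-n)] from below by a sum of weighted indicators of nested
   squares, each of which contributes equally to the integral. *)
Lemma dyadic_count_le (R : realType) (n : nat) (s : R) : 0 <= s ->
  (\sum_(k < n) 4 ^+ k * (s <= 2 ^- k)%R%:R) * (s ^+ 2 + 4 ^- n) <= 2.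
Proof.
move=> s0; elim: n => [|n IH]; first by rewrite big_ord0 mul0r.
have p4 m : 0 < (4 : R) ^+ m by rewrite exprn_gt0.
rewrite big_ord_recr /=; have [sn|ns] := leP s (2 ^- n); last first.
  rewrite mulr0 addr0; apply: le_trans IH; apply: ler_wpM2l.
    by apply: sumr_ge0 => k _; rewrite mulr_ge0// exprn_ge0.
  by rewrite lerD2l lef_pV2 ?posrE// exprS; have := p4 n; lra.
(* Now [s <= 2^-n]. The geometric sum is at most [4^(n+1) / 3] and [s^2 + 4^-(n+1)] at most
   [5 * 4^-(n+1)], so the product is at most [5 / 3]. *)
rewrite mulr1.
have S m : \sum_(k < m) 4 ^+ k * (s <= 2 ^- k)%R%:R <= ((4 : R) ^+ m - 1) / 3.
  elim: m => [|m IHm]; first by rewrite big_ord0 expr0 subrr mul0r.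
  rewrite big_ord_recr /= exprS.
  have : 4 ^+ m * (s <= 2 ^- m)%R%:R <= (4 : R) ^+ m.
    by case: (s <= _)%R; rewrite ?mulr1 ?mulr0 ?exprn_ge0.
  by lra.
have s2 : s ^+ 2 <= 4 ^- n.
  have -> : 4 ^- n = (2 ^- n) ^+ 2 :> R.
    by rewrite -exprVn -exprVn -exprM mulnC exprM; congr (_ ^+ n); field.
  by rewrite ler_pXn2r ?nnegrE// invr_ge0 exprn_ge0.
have t2 : s ^+ 2 + 4 ^- n.+1 <= 5 * 4 ^- n.+1.
  move: s2; have -> : 4 ^- n = 4 * 4 ^- n.+1 :> R by rewrite exprS invfM mulrA divff
      ?mul1r ?pnatr_eq0.
  by lra.
have t1 : \sum_(k < n) (4 : R) ^+ k * (s <= 2 ^- k)%R%:R + 4 ^+ n <= 4 ^+ n.+1 / 3.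
  by have := S n; have := p4 n; rewrite exprS; lra.
apply: (@le_trans _ _ (4 ^+ n.+1 / 3 * (5 * 4 ^- n.+1))).
  apply: ler_pM => //.
    by rewrite addr_ge0 ?exprn_ge0// sumr_ge0// => k _; rewrite mulr_ge0// exprn_ge0.
  by rewrite addr_ge0 ?sqr_ge0// invr_ge0 exprn_ge0.
rewrite (_ : _ * _ = 5 / 3); first by lra.
by field; rewrite lt0r_neq0.
Qed.

Definition lebesgue2 (R : realType) :
    {sigma_finite_measure set (measurableTypeR R * measurableTypeR R)%type -> \bar R} :=
  product_sf (@lebesgue_measure R) (@lebesgue_measure R).

Lemma lebesgue2_rectangle (R : realType) (a b c d : R) : a <= b -> c <= d ->
  lebesgue2 R (`[a, b] `*` `[c, d]) = ((b - a) * (d - c))%:E.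
Proof.
move=> ab cd.
have l (x y : R) : x <= y -> @lebesgue_measure R `[x, y] = (y - x)%:E.
  move=> xy; rewrite lebesgue_measure_itv/= lte_fin; case: ltgtP xy => // -> _.
  by rewrite subrr.
transitivity (@lebesgue_measure R `[a, b] * @lebesgue_measure R `[c, d])%E.
  by apply: product_measure1E; exact: measurable_itv.
by rewrite !l// -EFinM.
Qed.

(** A one-sided strip along part of the line [z1 + z2 = 0]. The bound [Re z1 <= - 1/4] keeps
    [|z1 - z2|] at least [1/2] on it. *)
Definition cell (R : realType) (r : R) :
    set ((measurableTypeR R * measurableTypeR R) * (measurableTypeR R * measurableTypeR
        R)) :=
  [set q | (`[- 2^-1, - 4^-1] `*` `[0, 4^-1])%classic q.1 /\
     (`[0, r] `*` `[0, r])%classic (q.1.1 + q.2.1, q.1.2 + q.2.2)].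

Lemma measurable_cell (R : realType) (r : R) : measurable (cell r).
Proof.
have mI (x y : R) : measurable (`[x, y]%classic : set (measurableTypeR R)).
  exact: measurable_itv.
apply: measurableI.
  rewrite -[X in measurable X]setTI; apply: measurable_fst => //.
  exact: measurableX.
have m : measurable_fun [set: (measurableTypeR R * measurableTypeR R) *
    (measurableTypeR R * measurableTypeR R)]
    (fun q => (q.1.1 + q.2.1 : measurableTypeR R, q.1.2 + q.2.2 : measurableTypeR R)).
  apply/measurable_fun_pairP; split; rewrite /comp /=;
    by apply: measurable_funD; exact: measurableT_comp.
rewrite -[X in measurable X]setTI; apply: m => //.
exact: measurableX.
Qed.

(** For fixed [z1] in a square of area [1/16], the slice in [z2] is a translate of [[0, r]^2]. *)
Lemma lebesgue4_cell (R : realType) (r : R) : 0 <= r ->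
  lebesgue4 R (cell r) = (r ^+ 2 / 16)%:E.
Proof.
move=> r0.
pose A : set (measurableTypeR R * measurableTypeR R) := `[- 2^-1, - 4^-1] `*` `[0, 4^-1].
have mA : measurable A by apply: measurableX; exact: measurable_itv.
have vA : lebesgue2 R A = (16^-1)%:E.
  rewrite lebesgue2_rectangle; [|lra|lra].
  by congr (_%:E); field.
transitivity (\int[lebesgue2 R]_p lebesgue2 R (xsection (cell r) p))%E; first by [].
transitivity (\int[lebesgue2 R]_(p in A) (r ^+ 2)%:E)%E; last first.
  transitivity ((r ^+ 2)%:E * lebesgue2 R A)%E; last by rewrite vA -EFinM.
  exact: integral_cst.
rewrite [RHS]integral_mkcond; apply: eq_integral => p _; rewrite patchE.
case: ifPn => [/set_mem pA|pA].
  rewrite (_ : xsection _ _ = `[- p.1, r - p.1] `*` `[- p.2, r - p.2]).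
    by rewrite lebesgue2_rectangle ?lerDr// !opprK !subrK expr2.
  apply/seteqP; split=> q.
    move=> /set_mem[_ [/= h1 h2]]; move: h1 h2; rewrite !in_itv /=.
    move=> /andP[h1 h2] /andP[h3 h4].
    by split; apply/andP; split; lra.
  move=> [/=]; rewrite !in_itv /= => /andP[h1 h2] /andP[h3 h4].
  apply/mem_set; split => //.
  by split; rewrite /= in_itv /=; apply/andP; split; lra.
rewrite (_ : xsection _ _ = set0) ?measure0//.
apply/seteqP; split=> q // /set_mem[pA' _].
by move: pA; rewrite mem_set.
Qed.

(** The numerator of the density is at least [1/4] and its denominator at most [(s^2 + 4^-n) / 8],
    so the density is at least [2 / (s^2 + 4^-n)]. This in turn dominates the sum by
    [dyadic_count_le]. *)
Lemma density_cell_ge (R : realType) (n k : nat)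
    (q : (measurableTypeR R * measurableTypeR R) * (measurableTypeR R * measurableTypeR
        R)) :
  cell (2 ^- k / 4) q ->
  bidisk4 q /\
  \sum_(j < n) 4 ^+ j * \1_(cell (2 ^- j / 4)) q <= density (@coord_diff R) (2 ^- n /
      4) q.
Proof.
case: q => -[x1 y1] [x2 y2] [[/= + +] [/= + +]]; rewrite !in_itv /=.
move=> /andP[x1a x1b] /andP[y1a y1b] /andP[ua ub] /andP[va vb].
set u := x1 + x2 in ua ub; set v := y1 + y2 in va vb.
have r1 : 2 ^- k <= 1 :> R by rewrite invf_le1 ?exprn_gt0// exprn_ege1// ler1n.
have u4 : u <= 4^-1 by lra.
have v4 : v <= 4^-1 by lra.
have sq (a b : R) : `|a| <= b -> a ^+ 2 <= b ^+ 2.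
  move=> ab; rewrite -real_normK ?num_real// ler_pXn2r ?nnegrE//.
  exact: le_trans ab.
(* In the cells [|Re|] is at most [3/4] and [|Im|] at most [1/4] for both coordinates, and
   [9/16 + 1/16 < 1]. *)
have md (a b : R) : `|a| <= 3 / 4 -> `|b| <= 4^-1 -> modulus (a +i* b)%C < 1.
  move=> /sq a2 /sq b2; rewrite -(@ltr_pXn2r _ 2) ?nnegrE ?modulus_ge0// sqr_modulus /=
      expr1n.
  by apply: (le_lt_trans (lerD a2 b2)); lra.
split.
  by split; apply: md; rewrite /= ler_norml; apply/andP; split;
    rewrite /u /v in ua ub va vb u4 v4; lra.
(* With this scaling, membership in the cell of side [2^-j / 4] implies [s <= 2^-j]. *)
pose s := 4 * Num.max u v.
have s0 : 0 <= s by rewrite mulr_ge0// le_max ua.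
have us : u <= s / 4 by rewrite /s mulrC mulKf ?pnatr_eq0// le_max lexx.
have vs : v <= s / 4 by rewrite /s mulrC mulKf ?pnatr_eq0// le_max lexx orbT.
have p4 : 0 < (4 : R) ^- n by rewrite invr_gt0 exprn_gt0.
have S0 : 0 < s ^+ 2 + 4 ^- n by rewrite ltr_wpDl ?sqr_ge0.
apply: (@le_trans _ _ (2 / (s ^+ 2 + 4 ^- n))).
  rewrite ler_pdivlMr//; apply: le_trans (dyadic_count_le n s0).
  apply: (ler_wpM2r (ltW S0)); apply: ler_sum => j _; rewrite ler_wpM2l ?exprn_ge0//.
  rewrite indicE; case: (boolP (_ \in _)) => [/set_mem[_ [/= h1 h2]]|_]; last by
      rewrite ler0n.
  move: h1 h2; rewrite !in_itv /= -/u -/v => /andP[_ h1] /andP[_ h2].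
  suff -> : (s <= 2 ^- j)%R by [].
  by rewrite /s -ler_pdivlMl// mulrC ge_max h1 h2.
have eE : (2 ^- n / 4) ^+ 2 = 4 ^- n / 16 :> R.
  rewrite exprMn (_ : (2 ^- n) ^+ 2 = 4 ^- n); first by field; rewrite lt0r_neq0//
      exprn_gt0.
  by rewrite -exprVn -exprVn -exprM mulnC exprM; congr (_ ^+ n); field.
have e0 : 0 < 2 ^- n / 4 :> R by rewrite divr_gt0// invr_gt0 exprn_gt0.
have w0 := wden_gt0 (to_C2 ((x1, y1), (x2, y2))) e0.
(* Both [u] and [v] are at most [s / 4], whence [u^2 + v^2 <= s^2 / 8]. *)
have wE : wden (2 ^- n / 4) (to_C2 ((x1, y1), (x2, y2))) <= (s ^+ 2 + 4 ^- n) / 8.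
  rewrite /wden sqr_modulus /= -/u -/v eE.
  have us2 : u ^+ 2 <= (s / 4) ^+ 2 by apply: sq; rewrite ger0_norm.
  have vs2 : v ^+ 2 <= (s / 4) ^+ 2 by apply: sq; rewrite ger0_norm.
  apply: (@le_trans _ _ ((s / 4) ^+ 2 + (s / 4) ^+ 2 + 4 ^- n / 16)); first by rewrite
      lerD2r lerD.
  have s2 := sqr_ge0 s.
  by rewrite expr_div_n; lra.
(* The real part of [z1 - z2] is [2 x1 - u], at most [- 1/2]. *)
have dE : 4^-1 <= modulus (coord_diff (to_C2 ((x1, y1), (x2, y2)))) ^+ 2.
  rewrite sqr_modulus /= ler_wpDr ?sqr_ge0//.
  rewrite (_ : 4^-1 = 2^-1 ^+ 2 :> R); last by field.
  rewrite -[leRHS]sqrrN ler_pXn2r ?nnegrE//; first by rewrite /u in ua ub u4; lra.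
  by rewrite /u in ua ub u4; lra.
rewrite /density ler_pdivlMr// mulrAC ler_pdivrMr//.
apply: (@le_trans _ _ (2 * ((s ^+ 2 + 4 ^- n) / 8))); first by rewrite ler_wpM2l.
rewrite (_ : 2 * _ = 4^-1 * (s ^+ 2 + 4 ^- n)); last by field.
by rewrite ler_wpM2r// ltW.
Qed.

Lemma sqnorm_density_in (R : realType) (g : C2 R -> Cplx R) (e : R) : 0 < e ->
  sqnorm (weight e) g =
  (\int[lebesgue4 R]_(q in @bidisk4 R) (density g e q)%:E)%E.
Proof. by move=> e0; rewrite sqnorm_density// [RHS]integral_mkcond. Qed.

(** Each of the [n] weighted indicators integrates to [4^k (2^-k / 4)^2 / 16 = 1/256], independently
    of [k]; [n] is of the order of the logarithm of [1 / e]. *)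
Lemma sqnorm_coord_diff_ge (R : realType) (n : nat) :
  ((n%:R / 256)%:E <= sqnorm (weight (2 ^- n / 4)) (@coord_diff R))%E.
Proof.
have e0 : 0 < 2 ^- n / 4 :> R by rewrite divr_gt0// invr_gt0 exprn_gt0.
have hh : holomorphic2 (@bidisk R) (@coord_diff R).
  by move=> z _; exact: differentiable_coord_diff.
have [mB mh] := measurable_density e0 hh.
pose r (k : nat) : R := 2 ^- k / 4.
have r0 k : 0 <= r k by rewrite divr_ge0// invr_ge0 exprn_ge0.
pose g (k : nat) (q : (measurableTypeR R * measurableTypeR R) *
  (measurableTypeR R * measurableTypeR R)) : \bar R := ((4 ^+ k)%:E * (\1_(cell (r k))
      q)%:E)%E.
have mi k : measurable_fun [set: (measurableTypeR R * measurableTypeR R) *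
  (measurableTypeR R * measurableTypeR R)] (fun q => (\1_(cell (r k)) q)%:E : \bar R).
  apply/measurable_EFinP; apply: measurable_indic; exact: measurable_cell.
have i0 k q : (0 <= (\1_(cell (r k)) q)%:E :> \bar R)%E by rewrite lee_fin.
have c0 k : (0 <= (4 ^+ k)%:E :> \bar R)%E by rewrite lee_fin exprn_ge0.
have mg k : measurable_fun [set: (measurableTypeR R * measurableTypeR R) *
  (measurableTypeR R * measurableTypeR R)] (g k) by exact: measurable_funeM.
have g0 k q : (0 <= g k q)%E by rewrite mule_ge0.
rewrite sqnorm_density//.
apply: (@le_trans _ _ (\int[lebesgue4 R]_q \sum_(k < n) g k q)%E).
  rewrite ge0_integral_sum//.
  rewrite (eq_bigr (fun=> (256^-1)%:E)); last first.
    move=> k _; rewrite (ge0_integralZl (lebesgue4 R) measurableT (mi k) (fun q _ => i0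
        k q) (c0 k)).
    rewrite integral_indic//; last exact: measurable_cell.
    rewrite setIT; transitivity ((4 ^+ k)%:E * lebesgue4 R (cell (r k)))%E; first by [].
    rewrite lebesgue4_cell// -EFinM; congr (_%:E).
    rewrite /r exprMn (_ : (2 ^- k) ^+ 2 = 4 ^- k); first by field; rewrite lt0r_neq0//
        exprn_gt0.
    by rewrite -exprVn -exprVn -exprM mulnC exprM; congr (_ ^+ k); field.
  by rewrite sumEFin lee_fin sumr_const card_ord mulr_natl.
apply: ge0_le_integral => //.
- by move=> q _; apply: sume_ge0 => k _.
- exact: emeasurable_sum.
- by apply/(measurable_restrictT _ mB)/measurable_EFinP.
move=> q _.
have -> : (\sum_(k < n) g k q)%E = (\sum_(k < n) 4 ^+ k * \1_(cell (r k)) q)%:E.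
  by rewrite -sumEFin; apply: eq_bigr => k _; rewrite EFinM.
have [[k ck]|nc] := pselect (exists k, cell (r k) q).
  have [qb le] := density_cell_ge n ck.
  by rewrite patchE mem_set.
rewrite big1; last first.
  by move=> k _; rewrite indicE memNset ?mulr0// => ck; apply: nc; exists k.
by rewrite patchE; case: ifP => // _; rewrite lee_fin density_ge0.
Qed.

(** * Finiteness, minimality and the contradiction *)

(** The density is at most [4 / e^2], which splits as [2 / e] for each coordinate; the 4 in the
    bound is the area of the square [[-1, 1]^2] around the disk. *)
Lemma sqnorm_coord_diff_fin (R : realType) (e : R) : 0 < e ->
  (sqnorm (weight e) (@coord_diff R) < +oo)%E.
Proof.
move=> e0; have hh : holomorphic2 (@bidisk R) (@coord_diff R).
  by move=> z _; exact: differentiable_coord_diff.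
have [mB mh] := measurable_density e0 hh.
have e20 : 0 < e ^+ 2 by rewrite exprn_gt0.
pose B : set (measurableTypeR R * measurableTypeR R) := `[-1, 1] `*` `[-1, 1].
have mBx : measurable B by apply: measurableX; exact: measurable_itv.
have c0 : 0 <= 2 / e by rewrite divr_ge0// ltW.
rewrite sqnorm_density_in//.
apply: (@le_lt_trans _ _ ((2 / e * 4) * (2 / e * 4))%:E); last exact: ltry.
apply: (@ge0_integral_le_prod _ _ R (lebesgue2 R) _ _ (fun p => 2 / e * \1_B p)) => //.
- exact/measurable_EFinP.
- by move=> q _; rewrite lee_fin density_ge0.
- move=> q qb; rewrite lee_fin.
  have inB (p : R * R) : modulus (to_C p) < 1 -> \1_B p = 1 :> R.
    move=> pm; rewrite indicE mem_set//; split; rewrite /= in_itv/= -ler_norml.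
      exact: (le_trans (@Re_le_modulus R (to_C p)) (ltW pm)).
    exact: (le_trans (@Im_le_modulus R (to_C p)) (ltW pm)).
  case: qb => q1 q2; rewrite !inB// !mulr1 -expr2 expr_div_n /density.
  have wge : e ^+ 2 <= wden e (to_C2 q) by rewrite lerDr sqr_ge0.
  have dle : modulus (coord_diff (to_C2 q)) <= 2.
    rewrite (le_trans (modulusD_le _ _))// modulusN.
    by rewrite (_ : 2 = 1 + 1)// lerD// ltW.
  apply: ler_pM; [exact: sqr_ge0|by rewrite invr_ge0 ltW// wden_gt0| |].
    by rewrite ler_pXn2r ?nnegrE ?modulus_ge0.
  by rewrite lef_pV2 ?posrE ?wden_gt0.
- by apply: measurable_funM => //; exact: measurable_indic.
- by move=> p; rewrite mulr_ge0.
under eq_integral do rewrite EFinM.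
rewrite ge0_integralZl//; last by apply/measurable_EFinP; exact: measurable_indic.
have -> : (\int[lebesgue2 R]_x (\1_B x)%:E = 4%:E)%E.
  rewrite integral_indic// setIT; transitivity (lebesgue2 R B); first by [].
  by rewrite lebesgue2_rectangle; [congr (_%:E); ring|lra|lra].
by rewrite -EFinM.
Qed.

Lemma minimal_extension_coord_diff (R : realType) (e : R) : 0 < e ->
  minimal_extension (weight e) (fun w : Cplx R => - w) id (@coord_diff R).
Proof.
move=> e0; split.
  split.
  - split; last exact: sqnorm_coord_diff_fin.
    by move=> z _; exact: differentiable_coord_diff.
  - by move=> w _; rewrite /on_V1 /coord_diff /= sub0r.
  - by move=> w _; rewrite /on_V2 /coord_diff /= subr0.
move=> g [[hg _] g1 g2]; exact: sqnorm_coord_diff_le.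
Qed.

Theorem claim4 (R : realType) :
  ~ exists C : R,
      forall phi : C2 R -> \bar R, psh (@bidisk R) phi ->
      forall f1 f2 : Cplx R -> Cplx R,
        holomorphic_on_V f1 f2 -> f1 0 = 0 -> f2 0 = 0 ->
      forall h : C2 R -> Cplx R, minimal_extension phi f1 f2 h ->
        (sqnorm phi h <=
           C%:E * (sqnorm_V phi f1 f2 +
                   sqnorm_V phi (twisted_d (on_V1 phi) f1)
                                (twisted_d (on_V2 phi) f2)))%E.

Proof.
move=> [C HC].
pose K : R := 8 + 2 * (pi * pi).
have K0 : 0 <= K by rewrite addr_ge0// mulr_ge0// mulr_ge0// pi_ge0.
(* Chosen so that [n / 256] exceeds [|C| K]. The absolute value covers a negative [C]. *)
pose n := (Num.truncn (256 * (`|C| * K))).+1.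
pose e : R := 2 ^- n / 4.
have e0 : 0 < e by rewrite divr_gt0// invr_gt0 exprn_gt0.
have hV : holomorphic_on_V (fun w : Cplx R => - w) id.
  split; last by rewrite oppr0.
  - by move=> z _; apply: derivableN; exact: derivable_id.
  - by move=> z _; exact: derivable_id.
have := HC (weight e) (psh_weight e0) _ _ hV (oppr0 _) erefl _
  (minimal_extension_coord_diff e0).
have := sqnorm_V_weight_le e0; set B := (sqnorm_V _ _ _ + _)%E => BK.
have wsq0 (w : Cplx R) (t : \bar R) : (0 <= wsq w t)%E.
  by rewrite mule_ge0 ?expeR_ge0// lee_fin sqr_ge0.
have V0 phi (f g : Cplx R -> Cplx R) : (0 <= sqnorm_V phi f g)%E.
  by apply: adde_ge0; apply: integral_ge0 => p _; exact: wsq0.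
have B0 : (0 <= B)%E by apply: adde_ge0; exact: V0.
(* Finiteness of the right-hand side moves the inequality from the extended reals to [R]. *)
have Bfin : B \is a fin_num by rewrite ge0_fin_numE// (le_lt_trans BK)// ltry.
rewrite -(fineK Bfin) in BK B0 *.
move=> /(le_trans (sqnorm_coord_diff_ge R n)); rewrite -EFinM lee_fin => H.
rewrite lee_fin in BK; rewrite lee_fin in B0.
have CB : C * fine B <= `|C| * K.
  by rewrite (le_trans (ler_wpM2r B0 (ler_norm C)))// ler_wpM2l.
have nlt := truncnS_gt (256 * (`|C| * K)); rewrite -/n in nlt.
have := le_trans H CB; rewrite ler_pdivrMr ?ltr0n// mulrC => /(lt_le_trans nlt).
by rewrite ltxx.
Qed.
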